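(* Let $n\ge 3$ be an integer. Then the symmetrized $n$-disc $\mathbb{G}_n=\sigma_n(\mathbb{D}^n)\subset\mathbb{C}^n$ cannot be exhausted by domains biholomorphic to convex domains.
   Context: $\mathbb{D}$ denotes the open unit disc in $\mathbb{C}$. The map $\sigma_n=(\sigma_{n,1},\dots,\sigma_{n,n}):\mathbb{C}^n\to\mathbb{C}^n$ is given by the elementary symmetric polynomials $$\sigma_{n,k}(z_1,\dots,z_n)=\sum_{1\le j_1<\dots<j_k\le n}z_{j_1}\cdots z_{j_k},\qquad 1\le k\le n.$$ The set $\mathbb{G}_n=\sigma_n(\mathbb{D}^n)$, which is a domain in $\mathbb{C}^n$, is called the symmetrized $n$-disc (symmetrized polydisc). A domain is a nonempty connected open set. A domain $D\subset\mathbb{C}^n$ can be exhausted by domains biholomorphic to convex domains if for every compact set $K\subset D$ there is a domain $D'$ with $K\subset D'\subset D$ such that $D'$ is biholomorphic to some convex domain in $\mathbb{C}^n$. *)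

(* Defs.v *)
From HB Require Import structures.
From mathcomp Require Import all_boot all_order all_algebra.
From mathcomp Require Import complex.
From mathcomp Require Import all_classical all_reals all_analysis.

Set Implicit Arguments.
Unset Strict Implicit.
Unset Printing Implicit Defensive.

Import Order.TTheory GRing.Theory Num.Theory.
Import numFieldNormedType.Exports.

Local Open Scope classical_set_scope.
Local Open Scope ring_scope.

(* Lets [R[i]] be found as a topological space; this is the structure that any
   [numFieldType] carries. *)
HB.instance Definition _ (R : realType) :=
  NormedModule.copy R[i] (R[i] : numFieldType)^o.

(* C^n is ['rV[R[i]]_n] with its normed-module structure over the field
   [R[i]]: the topology is the usual one (sup norm), and [differentiable]
   means complex (Frechet) differentiable. *)

Definition domain (T : topologicalType) (D : set T) : Prop :=
  [/\ D !=set0, open D & connected D].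

Definition holomorphic_on (R : realType) (V W : normedModType R[i])
    (D : set V) (f : V -> W) : Prop :=
  forall z, D z -> differentiable f z.

(* The maps are total functions whose values outside [D], resp. [E], are
   irrelevant. *)
Definition biholomorphic (R : realType) (V W : normedModType R[i])
    (D : set V) (E : set W) : Prop :=
  exists (f : V -> W) (g : W -> V),
    [/\ holomorphic_on D f, holomorphic_on E g,
        (forall z, D z -> E (f z) /\ g (f z) = z) &
        (forall w, E w -> D (g w) /\ f (g w) = w)].

(* [convex_set] takes its weights in [R[i]]; the order on [R[i]] compares only
   numbers with equal imaginary parts, so the weights between 0 and 1 are
   exactly the real numbers of [0, 1] and this is ordinary convexity. *)
Definition convex_exhaustible (R : realType) (n : nat)
    (D : set 'rV[R[i]]_n) : Prop :=
  forall K : set 'rV[R[i]]_n, compact K -> K `<=` D ->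
  exists D' : set 'rV[R[i]]_n,
    [/\ domain D', K `<=` D', D' `<=` D &
        exists E : set 'rV[R[i]]_n,
          [/\ domain E, convex_set E & biholomorphic D' E]].

Definition elem_sym (R : realType) (n k : nat) (z : 'rV[R[i]]_n) : R[i] :=
  \sum_(J : {set 'I_n} | #|J| == k) \prod_(j in J) z 0 j.

(* Coordinates are indexed from 0: coordinate [k] is the elementary symmetric
   polynomial of degree [k.+1]. *)
Definition sigma (R : realType) (n : nat) (z : 'rV[R[i]]_n) : 'rV[R[i]]_n :=
  \row_(k < n) elem_sym k.+1 z.

Definition polydisc (R : realType) (n : nat) : set 'rV[R[i]]_n :=
  [set z | forall j, `|z 0 j| < 1].
Arguments polydisc : clear implicits.

Definition symmetrized_polydisc (R : realType) (n : nat) : set 'rV[R[i]]_n :=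
  @sigma R n @` polydisc R n.
Arguments symmetrized_polydisc : clear implicits.

(* Main.v *)
Require Import Defs.
From mathcomp Require Import all_boot all_order all_algebra.
From mathcomp Require Import complex.
From mathcomp Require Import all_classical all_reals all_analysis.
From mathcomp Require Import ring lra zify.

(* A point [a] of the symmetrized polydisc is a monic polynomial of degree n with
   all roots in the unit disc; [l . a = (l^k a_k)_k] multiplies the roots by [l].
   Take [a], [b] in it whose coordinates of index at most n/2 vanish, and a
   biholomorphism [f] from a neighbourhood of all [l . a], [l . b], |l| <= 1, onto
   a convex set. Then [phi l = f^-1 ((f (l . a) + f (l . b)) / 2)] stays in the
   symmetrized polydisc. Since [l . a] and [l . b] are O(l^N) with 2N > n, the
   second-order error of [phi l] as a midpoint is O(l^(n+1)), so that
   [l^-1 . phi l] extends continuously to [l = 0] with value [(a + b) / 2]. A maximum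
   principle in [l] shows that the roots of the polynomial [(a + b) / 2] are in
   the closed disc. This fails for suitable pairs of trinomials.

   The maximum principle is applied to the coefficients of the inverse power
   series of the reversed polynomial: they are polynomials in the coordinates,
   they grow polynomially when the roots are in the closed disc, and conversely
   such a growth leaves no zero in the open disc. Complex differentiability does
   not include continuity of the derivative, so Cauchy's estimates are obtained
   by Goursat's subdivision, in polar coordinates around the center. *)

Set Implicit Arguments.
Unset Strict Implicit.
Unset Printing Implicit Defensive.

Import Order.TTheory GRing.Theory Num.Theory.
Import numFieldNormedType.Exports.

Local Open Scope classical_set_scope.
Local Open Scope ring_scope.
Local Open Scope complex_scope.

Local Notation Re := (@complex.Re _).
Local Notation Im := (@complex.Im _).

(** * Primitives of continuous functions, and Goursat's subdivision of rectangles *)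

Lemma primitive_exists (R : realType) (g : R -> R) (a b : R) : a <= b ->
  {within `[a, b], continuous g} ->
  exists G : R -> R, {within `[a, b], continuous G} /\
    forall x, x \in `]a, b[ -> is_derive x 1 G (g x).
Proof.
move=> ab gc.
have gi : (@lebesgue_measure R).-integrable `[a, b] (EFin \o g).
  exact: continuous_compact_integrable (@segment_compact _ _ _) gc.
exists (fun x => parameterized_integral (@lebesgue_measure R) a x g); split.
  exact: parameterized_integral_continuous.
move=> x xab.
have gcx : {for x, continuous g}.
  move: (xab); rewrite in_itv /= => /andP[ax xb].
  by case/(continuous_within_itvP _ (lt_trans ax xb)) : gc => + _ _; apply.
move: xab; rewrite in_itv /= => /andP[ax xb].
have [d1 d2] := continuous_FTC1_closed xb gi ax gcx.
by apply: DeriveDef => //; rewrite -derive1E.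
Qed.

Section MixedDifference.
Context {R : realType}.
Implicit Types (P u v U V : R -> R -> R).

(** If [P = U - V] with [u] the y-derivative of [U] and [v] the x-derivative of [V], this stands for
    the integral of v dx + u dy around the rectangle, the imaginary part of the contour integral of
    u + i v. *)
Definition mixed_diff P (a b c d : R) : R := P b d - P b c - P a d + P a c.

(** The mixed difference is the sum of those of the four quarters, while [(l + h) ^+ 2] is divided
    by 4: some quarter exceeds the same bound. *)
Lemma bisection_step P (a c l h e : R) :
  e * (l + h) ^+ 2 < `|mixed_diff P a (a + l) c (c + h)| ->
  exists p : R * R, [/\ (p.1 = a) \/ (p.1 = a + l / 2), (p.2 = c) \/ (p.2 = c + h / 2) &
   e * (l / 2 + h / 2) ^+ 2 < `|mixed_diff P p.1 (p.1 + l / 2) p.2 (p.2 + h / 2)|].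
Proof.
move=> big; apply: contrapT => no.
have small p1 p2 : p1 = a \/ p1 = a + l / 2 -> p2 = c \/ p2 = c + h / 2 ->
    `|mixed_diff P p1 (p1 + l / 2) p2 (p2 + h / 2)| <= e * (l + h) ^+ 2 / 4.
  move=> p1E p2E; rewrite leNgt; apply/negP => lt; apply: no; exists (p1, p2).
  split=> //=; apply: le_lt_trans lt; rewrite le_eqVlt; apply/orP; left.
  by apply/eqP; field.
have s1 := small _ _ (or_introl erefl) (or_introl erefl).
have s2 := small _ _ (or_introl erefl) (or_intror erefl).
have s3 := small _ _ (or_intror erefl) (or_introl erefl).
have s4 := small _ _ (or_intror erefl) (or_intror erefl).
move: big; apply/negP; rewrite -leNgt.
have hal (x y : R) : x + y / 2 + y / 2 = x + y by field.
move: s1 s2 s3 s4; rewrite /mixed_diff !hal => s1 s2 s3 s4.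
set q := e * _ in s1 s2 s3 s4 *.
move: s1 s2 s3 s4; rewrite !ler_norml =>
  /andP[s1 s1'] /andP[s2 s2'] /andP[s3 s3'] /andP[s4 s4'].
by apply/andP; split; lra.
Qed.

(* Goursat's subdivision argument: a nonzero mixed difference survives, relative
   to the square of the size, on a nested sequence of rectangles. *)
Lemma mixed_diff_eq0 P (a c l h : R) : 0 <= l -> 0 <= h ->
  (forall x y, a <= x <= a + l -> c <= y <= c + h -> forall e, 0 < e ->
    exists2 d, 0 < d & forall a' c' l' h', 0 <= l' -> 0 <= h' ->
      a <= a' -> a' <= x <= a' + l' -> a' + l' <= a + l ->
      c <= c' -> c' <= y <= c' + h' -> c' + h' <= c + h ->
      l' + h' < d ->
      `|mixed_diff P a' (a' + l') c' (c' + h')| <= e * (l' + h') ^+ 2) ->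
  mixed_diff P a (a + l) c (c + h) = 0.
Proof.
move=> l0 h0 loc; apply/eqP; rewrite -normr_le0 leNgt; apply/negP => J0.
have [e e0 big] : exists2 e, 0 < e &
    e * (l + h) ^+ 2 < `|mixed_diff P a (a + l) c (c + h)|.
  exists (`|mixed_diff P a (a + l) c (c + h)| / (2 * ((l + h) ^+ 2 + 1))).
    by rewrite divr_gt0// mulr_gt0// ltr_wpDl// sqr_ge0.
  set J := `|_|; set s := (l + h) ^+ 2.
  have s0 : 0 <= s by rewrite sqr_ge0.
  rewrite mulrAC ltr_pdivrMr; last by lra.
  by rewrite ltr_pM2l//; lra.
(* The state pairs a level, which fixes the side lengths, with the lower left corner; [(0, 0)] is a
   dummy value where the premise fails. *)
have /choice[step stepP] : forall q : nat * (R * R), exists p : R * R,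
    e * (l / 2 ^+ q.1 + h / 2 ^+ q.1) ^+ 2
      < `|mixed_diff P q.2.1 (q.2.1 + l / 2 ^+ q.1) q.2.2 (q.2.2 + h / 2 ^+ q.1)| ->
    [/\ (p.1 = q.2.1) \/ (p.1 = q.2.1 + l / 2 ^+ q.1.+1),
        (p.2 = q.2.2) \/ (p.2 = q.2.2 + h / 2 ^+ q.1.+1) &
     e * (l / 2 ^+ q.1.+1 + h / 2 ^+ q.1.+1) ^+ 2
       < `|mixed_diff P p.1 (p.1 + l / 2 ^+ q.1.+1) p.2 (p.2 + h / 2 ^+ q.1.+1)|].
  move=> [k [x y]] /=; have [/bisection_step[p pP]|no] :=
    boolP (e * (l / 2 ^+ k + h / 2 ^+ k) ^+ 2
      < `|mixed_diff P x (x + l / 2 ^+ k) y (y + h / 2 ^+ k)|); last by exists (0, 0).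
  by exists p => _; move: pP; rewrite !exprSr !invfM !mulrA.
pose s := fix s k := if k is k'.+1 then step (k', s k') else (a, c).
have sP k : e * (l / 2 ^+ k + h / 2 ^+ k) ^+ 2
  < `|mixed_diff P (s k).1 ((s k).1 + l / 2 ^+ k) (s k).2 ((s k).2 + h / 2 ^+ k)|.
  elim: k => [|k IH]; first by rewrite expr0 !divr1.
  by case: (stepP (k, s k) IH).
have pos2 k : 0 < 2 ^+ k :> R by rewrite exprn_gt0.
have half (z : R) k : z / 2 ^+ k = z / 2 ^+ k.+1 + z / 2 ^+ k.+1.
  by rewrite exprS; field; rewrite gt_eqF.
have step1 k : (s k).1 <= (s k.+1).1 /\ (s k.+1).1 + l / 2 ^+ k.+1 <= (s k).1 + l / 2 ^+ k.
  have lk : 0 <= l / 2 ^+ k.+1 by rewrite divr_ge0// ltW.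
  have [+ _ _] := stepP (k, s k) (sP k); rewrite (half l k) /=.
  by case=> ->; split; lra.
have step2 k : (s k).2 <= (s k.+1).2 /\ (s k.+1).2 + h / 2 ^+ k.+1 <= (s k).2 + h / 2 ^+ k.
  have lk : 0 <= h / 2 ^+ k.+1 by rewrite divr_ge0// ltW.
  have [_ + _] := stepP (k, s k) (sP k); rewrite (half h k) /=.
  by case=> ->; split; lra.
(* Nested intervals: the supremum of the left ends lies in all of them. *)
have lim (t : nat -> R) z : 0 <= z -> (forall k,
  t k <= t k.+1 /\ t k.+1 + z / 2 ^+ k.+1 <= t k + z / 2 ^+ k) ->
    exists x, forall k, t 0 <= t k /\ t k <= x <= t k + z / 2 ^+ k /\ t k + z / 2 ^+ k
      <= t 0 + z.
  move=> z0 tS.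
  have mono j k : (j <= k)%N -> t j <= t k /\ t k + z / 2 ^+ k <= t j + z / 2 ^+ j.
    elim: k => [|k IH]; first by rewrite leqn0 => /eqP->.
    rewrite leq_eqVlt => /orP[/eqP->//|]; rewrite ltnS => /IH[? ?].
    by have [? ?] := tS k; split; lra.
  have zk k : 0 <= z / 2 ^+ k by rewrite divr_ge0// ltW.
  have ub j k : t j <= t k + z / 2 ^+ k.
    have [/mono[? ?]|/ltnW/mono[? ?]] := leqP j k; have := zk k; have := zk j; lra.
  have hs : has_sup (range t).
    split; first by exists (t 0%N), 0%N.
    by exists (t 0%N + z / 2 ^+ 0) => _ [j _ <-]; exact: ub.
  exists (sup (range t)) => k; have [m1 m2] := mono _ _ (leq0n k).
  split=> //; split; last by move: m2; rewrite expr0 divr1.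
  apply/andP; split; first by apply: (ub_le_sup hs.2); exists k.
  by apply: ge_sup; [exact: hs.1|move=> _ [j _ <-]; exact: ub].
have [x xP] := lim (fun k => (s k).1) l l0 step1.
have [y yP] := lim (fun k => (s k).2) h h0 step2.
have [d d0 dP] : exists2 d, 0 < d & forall a' c' l' h', 0 <= l' -> 0 <= h' ->
      a <= a' -> a' <= x <= a' + l' -> a' + l' <= a + l ->
      c <= c' -> c' <= y <= c' + h' -> c' + h' <= c + h ->
      l' + h' < d ->
      `|mixed_diff P a' (a' + l') c' (c' + h')| <= e * (l' + h') ^+ 2.
  apply: loc => //.
    by have [_ [+ _]] := xP 0%N; rewrite expr0 divr1.
  by have [_ [+ _]] := yP 0%N; rewrite expr0 divr1.
have [k kd] : exists k, (l + h) / 2 ^+ k < d.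
  have := @cvg_geometric R (l + h) 2^-1.
  rewrite ger0_norm// invf_lt1// ltr1n =>
    /(_ isT) /cvgrPdist_lt/(_ _ d0)[k _ /(_ k (leqnn _))].
  rewrite /= sub0r normrN exprVn ger0_norm => [kd|]; first by exists k.
  by rewrite divr_ge0 ?addr_ge0// ltW.
have [x1 [x2 x3]] := xP k; have [y1 [y2 y3]] := yP k.
have /= := dP (s k).1 (s k).2 (l / 2 ^+ k) (h / 2 ^+ k).
rewrite -!mulrDl kd !divr_ge0// ?(ltW (pos2 _))//.
move=> /(_ isT isT x1 x2 x3 y1 y2 y3 isT); rewrite leNgt => /negP; apply.
by rewrite mulrDl; exact: sP.
Qed.

End MixedDifference.

(** * Total differentiability in two real variables, and Cauchy's theorem on a rectangle *)

Section Expansion.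
Context {R : realType}.

Definition expands (F : R -> R -> R) (x y A B : R) : Prop :=
  forall e, 0 < e -> exists2 d, 0 < d & forall x' y', `|x' - x| < d -> `|y' - y| < d ->
    `|F x' y' - F x y - (A * (x' - x) + B * (y' - y))| <= e * (`|x' - x| + `|y' - y|).

Lemma is_derive_expansion (g : R -> R) (x d : R) : is_derive x 1 g d ->
  forall e, 0 < e -> exists2 r, 0 < r & forall x', `|x' - x| < r ->
    `|g x' - g x - d * (x' - x)| <= e * `|x' - x|.
Proof.
move=> gd e e0.
have dg : derivable g x 1 by exact: ex_derive.
have gE : 'D_1 g x = d by exact: derive_val.
have : h^-1 *: (g (h *: 1 + x) - g x) @[h --> 0^'] --> d.
  by move: dg; rewrite /derivable -[lim _]/('D_1 g x) gE.
move/cvgrPdist_le => /(_ e e0); rewrite /= => /nbhs_ballP[r /= r0 rP].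
exists r => // x' x'r; have [->|x'x] := eqVneq x' x.
  by rewrite !subrr mulr0 subrr normr0 mulr0.
have x'x0 : x' - x != 0 by rewrite subr_eq0.
have := rP (x' - x); rewrite /ball /= sub0r normrN => /(_ x'r x'x0).
rewrite [_ *: 1]mulr1 subrK => H.
have -> : g x' - g x - d * (x' - x)
  = - ((d - (x' - x)^-1 * (g x' - g x)) * (x' - x)) by field.
by rewrite normrN normrM ler_wpM2r.
Qed.

Lemma MVT_sub (g1 g2 d1 d2 : R -> R) (p q : R) : p <= q ->
  {within `[p, q], continuous g1} -> {within `[p, q], continuous g2} ->
  (forall t, t \in `]p, q[ -> is_derive t 1 g1 (d1 t)) ->
  (forall t, t \in `]p, q[ -> is_derive t 1 g2 (d2 t)) ->
  exists2 t, t \in `[p, q] & g1 q - g2 q - (g1 p - g2 p) = (d1 t - d2 t) * (q - p).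
Proof.
move=> pq c1 c2 i1 i2.
apply: (@MVT_segment _ (fun t => g1 t - g2 t) (fun t => d1 t - d2 t)) => //.
  by move=> t tc; apply: is_deriveB; [exact: i1|exact: i2].
by move=> t; apply: cvgB; [exact: c1|exact: c2].
Qed.

Lemma dist_itv_le (p q r s : R) : q <= p <= q + r -> q <= s <= q + r -> `|p - s| <= r.
Proof.
by move=> /andP[? ?] /andP[? ?]; rewrite ler_norml; apply/andP; split; lra.
Qed.

Lemma dist_sub_le (a b c p q e m : R) :
  `|a - c - p| <= e / 2 * m -> `|b - c - q| <= e / 2 * m ->
  `|a - b - (p - q)| <= e * m.
Proof.
move=> ap bq; have -> : a - b - (p - q) = (a - c - p) - (b - c - q) by ring.
apply: le_trans (ler_normB _ _) _; apply: le_trans (lerD ap bq) _.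
by rewrite -mulrDl -splitr.
Qed.

(** The shared [A] is the Cauchy-Riemann equation between the x-derivative of [u] and the
    y-derivative of [v]. It cancels the linear parts, so that near each point the mixed difference
    is negligible against the squared size of the rectangle. *)
Lemma expands_mixed_diff (u v U V : R -> R -> R) (a c l h : R) :
  0 <= l -> 0 <= h ->
  (forall x, a <= x <= a + l -> {within `[c, c + h], continuous (U x)} /\
     forall y, y \in `]c, c + h[ -> is_derive y 1 (U x) (u x y)) ->
  (forall y, c <= y <= c + h -> {within `[a, a + l], continuous V^~ y} /\
     forall x, x \in `]a, a + l[ -> is_derive x 1 (V^~ y) (v x y)) ->
  (forall x y, a <= x <= a + l -> c <= y <= c + h ->
     exists A B B', expands u x y A B /\ expands v x y B' A) ->
  mixed_diff (fun x y => U x y - V x y) a (a + l) c (c + h) = 0.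
Proof.
move=> l0 h0 HU HV loc; apply: mixed_diff_eq0 => // x y xa yc e e0.
have [A [B [B' [eu ev]]]] := loc x y xa yc.
have e20 : 0 < e / 2 by rewrite divr_gt0.
have [d1 d10 du] := eu _ e20; have [d2 d20 dv] := ev _ e20.
exists (Num.min d1 d2); first by rewrite lt_min d10.
move=> a' c' l' h' l'0 h'0 aa' /andP[a'x xa'] al cc' /andP[c'y yc'] cl.
rewrite lt_min => /andP[lh1 lh2].
have sub (p q p' q' : R) : p <= p' -> q' <= q -> `[p', q'] `<=` `[p, q].
  by move=> pp qq; apply: subset_itv; rewrite bnd_simp.
have subo (p q p' q' t : R) : p <= p' -> q' <= q -> t \in `]p', q'[ -> t \in `]p, q[.
  by move=> pp qq; apply: subset_itv; rewrite bnd_simp.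
(* The mean value theorem turns the double increment of [U] into an increment of [u] at a common
   height [eta]; [xi] does the same for [V] and [v]. *)
have [eta etac E1] : exists2 eta, eta \in `[c', c' + h'] &
    (U (a' + l') (c' + h') - U a' (c' + h')) - (U (a' + l') c' - U a' c')
    = (u (a' + l') eta - u a' eta) * (c' + h' - c').
  have /HU[c1 i1] : a <= a' + l' <= a + l by rewrite al (le_trans aa')// lerDl.
  have /HU[c2 i2] : a <= a' <= a + l by rewrite aa' (le_trans _ al)// lerDl.
  have pq : c' <= c' + h' by rewrite lerDl.
  have := @MVT_sub (U (a' + l')) (U a') (u (a' + l')) (u a') _ _ pq.
  move=> /(_ (continuous_subspaceW (sub _ _ _ _ cc' cl) c1)).
  move=> /(_ (continuous_subspaceW (sub _ _ _ _ cc' cl) c2)).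
  move=> /(_ (fun t tc => i1 t (subo _ _ _ _ _ cc' cl tc))).
  by move=> /(_ (fun t tc => i2 t (subo _ _ _ _ _ cc' cl tc))).
have [xi xia E2] : exists2 xi, xi \in `[a', a' + l'] &
    (V (a' + l') (c' + h') - V (a' + l') c') - (V a' (c' + h') - V a' c')
    = (v xi (c' + h') - v xi c') * (a' + l' - a').
  have /HV[c1 i1] : c <= c' + h' <= c + h by rewrite cl (le_trans cc')// lerDl.
  have /HV[c2 i2] : c <= c' <= c + h by rewrite cc' (le_trans _ cl)// lerDl.
  have pq : a' <= a' + l' by rewrite lerDl.
  have := @MVT_sub (V^~ (c' + h')) (V^~ c') (v^~ (c' + h')) (v^~ c') _ _ pq.
  move=> /(_ (continuous_subspaceW (sub _ _ _ _ aa' al) c1)).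
  move=> /(_ (continuous_subspaceW (sub _ _ _ _ aa' al) c2)).
  move=> /(_ (fun t tc => i1 t (subo _ _ _ _ _ aa' al tc))).
  by move=> /(_ (fun t tc => i2 t (subo _ _ _ _ _ aa' al tc))).
clear HU HV loc sub subo eu ev.
(* The term [A * l' * h'] is subtracted from both products: here the two derivatives must agree. *)
have -> : mixed_diff (fun x y => U x y - V x y) a' (a' + l') c' (c' + h') =
   (u (a' + l') eta - u a' eta - A * l') * h' - (v xi (c' + h') - v xi c' - A * h') * l'.
  have -> : mixed_diff (fun x y => U x y - V x y) a' (a' + l') c' (c' + h') =
    (U (a' + l') (c' + h') - U a' (c' + h') - (U (a' + l') c' - U a' c')) -
    (V (a' + l') (c' + h') - V (a' + l') c' - (V a' (c' + h') - V a' c')).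
    by rewrite /mixed_diff; ring.
  by rewrite E1 E2; ring.
move: etac xia; rewrite !in_itv /= => /andP[n1 n2] /andP[k1 k2].
have xI : a' <= x <= a' + l' by apply/andP.
have yI : c' <= y <= c' + h' by apply/andP.
have lI : a' <= a' + l' <= a' + l' by rewrite lexx lerDl l'0.
have lI' : a' <= a' <= a' + l' by rewrite lexx lerDl l'0.
have hI : c' <= c' + h' <= c' + h' by rewrite lexx lerDl h'0.
have hI' : c' <= c' <= c' + h' by rewrite lexx lerDl h'0.
have etaI : c' <= eta <= c' + h' by apply/andP.
have xiI : a' <= xi <= a' + l' by apply/andP.
have l1 : l' < d1 by apply: le_lt_trans lh1; rewrite lerDl.
have l2 : l' < d2 by apply: le_lt_trans lh2; rewrite lerDl.
have h1 : h' < d1 by apply: le_lt_trans lh1; rewrite lerDr.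
have h2 : h' < d2 by apply: le_lt_trans lh2; rewrite lerDr.
have bu p q : a' <= p <= a' + l' -> c' <= q <= c' + h' ->
    `|u p q - u x y - (A * (p - x) + B * (q - y))| <= e / 2 * (l' + h').
  move=> pI qI; have bp := dist_itv_le pI xI; have bq := dist_itv_le qI yI.
  apply: le_trans (du _ _ (le_lt_trans bp l1) (le_lt_trans bq h1)) _.
  by rewrite ler_pM2l// lerD.
have bv p q : a' <= p <= a' + l' -> c' <= q <= c' + h' ->
    `|v p q - v x y - (B' * (p - x) + A * (q - y))| <= e / 2 * (l' + h').
  move=> pI qI; have bp := dist_itv_le pI xI; have bq := dist_itv_le qI yI.
  apply: le_trans (dv _ _ (le_lt_trans bp l2) (le_lt_trans bq h2)) _.
  by rewrite ler_pM2l// lerD.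
have nu : `|u (a' + l') eta - u a' eta - A * l'| <= e * (l' + h').
  have := dist_sub_le (bu _ _ lI etaI) (bu _ _ lI' etaI); congr (`|_| <= _); ring.
have nv : `|v xi (c' + h') - v xi c' - A * h'| <= e * (l' + h').
  have := dist_sub_le (bv _ _ xiI hI) (bv _ _ xiI hI'); congr (`|_| <= _); ring.
apply: le_trans (ler_normB _ _) _; rewrite !normrM (ger0_norm l'0) (ger0_norm h'0).
apply: le_trans (lerD (ler_wpM2r h'0 nu) (ler_wpM2r l'0 nv)) _.
by rewrite le_eqVlt; apply/orP; left; apply/eqP; ring.
Qed.

(** Serves the coordinates [expR s * cos t] and [expR s * sin t]. *)
Lemma expandsM (g k : R -> R) (x y dg dk : R) :
  is_derive x 1 g dg -> is_derive y 1 k dk ->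
  expands (fun s t => g s * k t) x y (dg * k y) (g x * dk).
Proof.
move=> /is_derive_expansion gP /is_derive_expansion kP e e0.
have k0 := normr_ge0 (k y); have g0 := normr_ge0 (g x).
have dg0 := normr_ge0 dg; have dk0 := normr_ge0 dk.
pose K := `|k y| + `|g x| + `|dg| + 2.
have K0 : 0 < K by rewrite /K; lra.
pose L := `|dk| + 1.
have L0 : 0 < L by rewrite /L; lra.
pose e1 := Num.min 1 (e / (2 * K)).
have e10 : 0 < e1 by rewrite lt_min ltr01 divr_gt0// mulr_gt0.
have [r1 r10 gr] := gP _ e10; have [r2 r20 kr] := kP _ e10.
pose e3 := e / (2 * (K * L)).
have e30 : 0 < e3 by rewrite divr_gt0// !mulr_gt0.
exists (Num.min (Num.min r1 r2) e3); first by rewrite !lt_min r10 r20 e30.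
move=> x' y'; rewrite !lt_min => /andP[/andP[x1 x2] x3] /andP[/andP[y1 y2] y3].
have {gr}gr := gr _ x1; have {kr}kr := kr _ y2.
set X := x' - x in x1 x2 x3 gr *; set Y := y' - y in y1 y2 y3 kr *.
set E := g x' - g x - dg * X in gr; set F := k y' - k y - dk * Y in kr.
have -> : g x' * k y' - g x * k y - (dg * k y * X + g x * dk * Y) =
  E * k y + g x * F + (E + dg * X) * (F + dk * Y) by rewrite /E /F; ring.
have e11 : e1 <= 1 by rewrite ge_min lexx.
have e12 : e1 * (2 * K) <= e by rewrite -ler_pdivlMr ?mulr_gt0// ge_min lexx orbT.
have b1 : `|E * k y| <= e1 * `|X| * `|k y| by rewrite normrM ler_wpM2r.
have b2 : `|g x * F| <= `|g x| * (e1 * `|Y|) by rewrite normrM ler_wpM2l.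
have b3 : `|E + dg * X| <= K * `|X|.
  apply: le_trans (ler_normD _ _) _; rewrite normrM.
  apply: (@le_trans _ _ (1 * `|X| + `|dg| * `|X|)).
    by rewrite lerD2r; apply: le_trans gr _; rewrite ler_wpM2r.
  rewrite -mulrDl ler_wpM2r// /K.
  lra.
have b4 : `|F + dk * Y| <= L * `|Y|.
  apply: le_trans (ler_normD _ _) _; rewrite normrM /L addrC mulrDl.
  by rewrite lerD2l; apply: le_trans kr _; rewrite ler_wpM2r.
have b5 : `|(E + dg * X) * (F + dk * Y)| <= e / 2 * `|Y|.
  rewrite normrM; apply: le_trans (ler_pM _ _ b3 b4) _ => //.
  have -> : e / 2 = K * L * e3 by rewrite /e3; field; rewrite !gt_eqF.
  have -> : K * `|X| * (L * `|Y|) = K * L * `|X| * `|Y| by ring.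
  by rewrite ler_wpM2r// ler_pM2l ?mulr_gt0// ltW.
apply: le_trans (ler_normD _ _) _; apply: le_trans (lerD (ler_normD _ _) b5) _.
apply: le_trans (lerD (lerD b1 b2) (lexx _)) _.
have X0 := normr_ge0 X; have Y0 := normr_ge0 Y.
have c1 : e1 * `|k y| <= e / 2.
  have : e1 * `|k y| <= e1 * K by rewrite ler_pM2l// /K; lra.
  lra.
have c2 : e1 * `|g x| <= e / 2.
  have : e1 * `|g x| <= e1 * K by rewrite ler_pM2l// /K; lra.
  lra.
have eX : 0 <= e * `|X| by rewrite mulr_ge0// ltW.
move: (ler_wpM2r X0 c1) (ler_wpM2r Y0 c2) eX; clear.
rewrite [_ * (e1 * _)]mulrA [_ * e1]mulrC [_ * _ * `|k y|]mulrAC; lra.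
Qed.

End Expansion.

(** * The modulus as a real number, and the chain rule for complex differentiable functions *)

Section ComplexAbs.
Context {R : realType}.
Implicit Types z w : R[i].

(** The norm of [R[i]] takes its values in [R[i]], whose order is partial; its real part allows real
    arithmetic. *)
Definition cabs z : R := Re `|z|.

Lemma cabsE z : (cabs z)%:C = `|z|.
Proof. by rewrite /cabs normc_def. Qed.

Lemma cabs_ge0 z : 0 <= cabs z.
Proof. by rewrite -ler0c cabsE. Qed.

Lemma cabsD z w : cabs (z + w) <= cabs z + cabs w.
Proof. by rewrite -lecR rmorphD/= !cabsE ler_normD. Qed.

Lemma cabsN z : cabs (- z) = cabs z.
Proof. by rewrite /cabs normrN. Qed.

Lemma cabsB z w : cabs (z - w) <= cabs z + cabs w.
Proof. by rewrite -(cabsN w); exact: cabsD. Qed.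

Lemma cabsM z w : cabs (z * w) = cabs z * cabs w.
Proof. by apply: complexI; rewrite rmorphM/= !cabsE normrM. Qed.

Lemma Re_le_cabs z : `|Re z| <= cabs z.
Proof. by rewrite -lecR cabsE; exact: normc_ge_Re. Qed.

Lemma Im_le_cabs z : `|Im z| <= cabs z.
Proof.
have := Re_le_cabs (z * 'i); rewrite ReiNIm normrN cabsM.
suff -> : cabs 'i = 1 by rewrite mulr1.
by rewrite /cabs normc_def /= expr0n expr1n add0r sqrtr1.
Qed.

Lemma cabs_le z : cabs z <= `|Re z| + `|Im z|.
Proof.
rewrite /cabs normc_def /= -[leRHS]ger0_norm ?addr_ge0// -sqrtr_sqr ler_wsqrtr//.
rewrite sqrrD !real_normK ?num_real// lerD2r lerDl.
by rewrite mulrn_wge0// mulr_ge0.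
Qed.

Lemma cabs_real (x : R) : cabs x%:C = `|x|.
Proof. by rewrite /cabs normc_def /= expr0n addr0 sqrtr_sqr. Qed.

Definition cderiv (f : R[i] -> R[i]) z (d : R[i]) : Prop :=
  forall e : R, 0 < e -> exists2 r : R, 0 < r & forall w, cabs (w - z) < r ->
    cabs (f w - f z - d * (w - z)) <= e * cabs (w - z).

Lemma differentiable_cderiv (f : R[i] -> R[i]) z : differentiable f z ->
  exists d, cderiv f z d.
Proof.
move=> /derivable1_diffP df; exists ('D_1 f z) => e e0.
have : h^-1 *: (f (h *: 1 + z) - f z) @[h --> 0^'] --> 'D_1 f z by exact: df.
move/cvgrPdist_le => /(_ e%:C); rewrite ltcR => /(_ e0) /= /nbhs_ballP[r /= r0 rP].
have rE : (Re r)%:C = r by rewrite RRe_real// gtr0_real.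
exists (Re r); first by rewrite -ltcR rE.
move=> w wr; have [->|wz] := eqVneq w z.
  by rewrite !subrr mulr0 subrr /cabs normr0 mulr0.
have wz0 : w - z != 0 by rewrite subr_eq0.
have := rP (w - z); rewrite /ball /= sub0r normrN -rE -cabsE ltcR => /(_ wr wz0).
rewrite [_ *: 1]mulr1 subrK -cabsE lecR => H.
have -> : f w - f z - 'D_1 f z * (w - z)
  = - (('D_1 f z - (w - z)^-1 * (f w - f z)) * (w - z)) by field.
by rewrite cabsN cabsM ler_wpM2r// cabs_ge0.
Qed.

(** Chain rule. Both gradients come from one complex number [d], the source of the Cauchy-Riemann
    equation. *)
Lemma expands_comp (f : R[i] -> R[i]) (X Y : R -> R -> R) (s t A1 B1 A2 B2 : R) :
  differentiable f (X s t +i* Y s t) ->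
  expands X s t A1 B1 -> expands Y s t A2 B2 ->
  exists d : R[i],
    expands (fun s t => Re (f (X s t +i* Y s t))) s t (Re (d * (A1 +i* A2))) (Re (d
      * (B1 +i* B2))) /\
    expands (fun s t => Im (f (X s t +i* Y s t))) s t (Im (d * (A1 +i* A2))) (Im (d
      * (B1 +i* B2))).
Proof.
move=> /differentiable_cderiv[d dP] eX eY; exists d.
suff main : forall e, 0 < e -> exists2 r, 0 < r & forall s' t',
  `|s' - s| < r -> `|t' - t| < r ->
    cabs (f (X s' t' +i* Y s' t') - f (X s t +i* Y s t) -
       (d * (A1 +i* A2) * (s' - s)%:C + d * (B1 +i* B2) * (t' - t)%:C))
         <= e * (`|s' - s| + `|t' - t|).
  have Re_real z (x : R) : Re (z * x%:C) = Re z * x.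
    by case: z => a b /=; rewrite mulr0 subr0.
  have Im_real z (x : R) : Im (z * x%:C) = Im z * x.
    by case: z => a b /=; rewrite mulr0 add0r.
  have ReD z w : Re (z + w) = Re z + Re w by case: z w => [? ?] [].
  have ImD z w : Im (z + w) = Im z + Im w by case: z w => [? ?] [].
  have ReN z : Re (- z) = - Re z by case: z.
  have ImN z : Im (- z) = - Im z by case: z.
  split=> e e0; have [r r0 rP] := main e e0; exists r => // s' t' ss tt.
    apply: le_trans (rP s' t' ss tt); apply: le_trans (Re_le_cabs _).
    by rewrite !(ReD, ReN, Re_real).
  apply: le_trans (rP s' t' ss tt); apply: le_trans (Im_le_cabs _).
  by rewrite !(ImD, ImN, Im_real).
move=> e e0.
pose K := `|A1| + `|A2| + `|B1| + `|B2| + 2.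
have K0 : 0 < K by rewrite ltr_wpDl// !addr_ge0.
pose D := cabs d + 1.
have D0 : 0 < D by rewrite ltr_wpDl// cabs_ge0.
(* [e1] bounds the errors of [X] and [Y], which [d] multiplies; [e2] bounds the error of [f] over a
   displacement of at most [K * h]. Each accounts for half of [e]. *)
pose e1 := Num.min 1 (e / (4 * D)).
have e10 : 0 < e1 by rewrite lt_min ltr01 divr_gt0// mulr_gt0.
pose e2 := e / (2 * K).
have e20 : 0 < e2 by rewrite divr_gt0// mulr_gt0.
have [r1 r10 r1P] := eX e1 e10; have [r2 r20 r2P] := eY e1 e10.
have [r3 r30 r3P] := dP e2 e20.
pose r4 := r3 / (2 * K).
have r40 : 0 < r4 by rewrite divr_gt0// mulr_gt0.
exists (Num.min (Num.min r1 r2) r4); first by rewrite !lt_min r10 r20.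
move=> s' t'; rewrite !lt_min => /andP[/andP[s1 s2] s3] /andP[/andP[t1 t2] t3].
have {r1P}EX := r1P _ _ s1 t1; have {r2P}EY := r2P _ _ s2 t2.
set h := `|s' - s| + `|t' - t| in EX EY *.
have h0 : 0 <= h by rewrite addr_ge0.
set S := s' - s in EX EY *; set T := t' - t in EX EY *.
pose E : R[i] := (X s' t' - X s t - (A1 * S + B1 * T)) +i* (Y s' t' - Y s t - (A2 * S
  + B2 * T)).
have EE : cabs E <= 2 * e1 * h.
  by apply: le_trans (cabs_le _) _; rewrite /= -mulrA mulr_natl mulr2n lerD.
set w' := X s' t' +i* Y s' t' in E EE *; set w := X s t +i* Y s t in E EE r3P *.
have wE : w' - w = (A1 +i* A2) * S%:C + (B1 +i* B2) * T%:C + E.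
  rewrite /w' /w /E; apply/eqP; rewrite eq_complex /=; apply/andP; split; apply/eqP; ring.
have e11 : e1 <= 1 by rewrite ge_min lexx.
have e12 : e1 * (4 * D) <= e by rewrite -ler_pdivlMr ?mulr_gt0// ge_min lexx orbT.
have wK : cabs (w' - w) <= K * h.
  rewrite wE; apply: le_trans (cabsD _ _) _.
  have b1 : cabs ((A1 +i* A2) * S%:C + (B1 +i* B2) * T%:C)
    <= (`|A1| + `|A2|) * h + (`|B1| + `|B2|) * h.
    apply: le_trans (cabsD _ _) _; rewrite !cabsM !cabs_real; apply: lerD; apply: ler_pM;
      rewrite ?cabs_ge0//.
    - exact: cabs_le.
    - by rewrite /h lerDl.
    - exact: cabs_le.
    - by rewrite /h lerDr.
  apply: le_trans (lerD b1 EE) _; rewrite -!mulrDl; apply: ler_wpM2r => //.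
  by rewrite /K; move: e11; clear; lra.
have hr : K * h < r3.
  apply: (@lt_le_trans _ _ (K * (r4 + r4))); first by rewrite ltr_pM2l// ltrD.
  by rewrite /r4 le_eqVlt; apply/orP; left; apply/eqP; field; rewrite gt_eqF.
have := r3P w' (le_lt_trans wK hr); rewrite wE => H.
have -> : f w' - f w - (d * (A1 +i* A2) * S%:C + d * (B1 +i* B2) * T%:C) =
  (f w' - f w - d * ((A1 +i* A2) * S%:C + (B1 +i* B2) * T%:C + E)) + d * E by ring.
apply: le_trans (cabsD _ _) _; rewrite cabsM.
have H2 : cabs d * cabs E <= D * (2 * e1 * h).
  by apply: ler_pM; rewrite ?cabs_ge0// lerDl.
have H3 : e2 * cabs (w' - w) <= e / 2 * h.
  apply: (@le_trans _ _ (e2 * (K * h))); first by rewrite ler_pM2l.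
  by rewrite /e2 le_eqVlt; apply/orP; left; apply/eqP; field; rewrite gt_eqF.
apply: le_trans (lerD H H2) _; rewrite -wE; apply: le_trans (lerD H3 (lexx _)) _.
rewrite mulrA -mulrDl ler_wpM2r//; move: e12; clear; lra.
Qed.

Lemma expandsDc (F : R -> R -> R) (x y A B c : R) :
  expands F x y A B -> expands (fun s t => c + F s t) x y A B.
Proof.
move=> eF e e0; have [r r0 rP] := eF e e0; exists r => // x' y' xr yr.
by have := rP x' y' xr yr; congr (`|_| <= _); ring.
Qed.

Lemma lipschitz_at_continuous (g : R -> R) (x K r : R) : 0 < r -> 0 <= K ->
  (forall x', `|x' - x| < r -> `|g x' - g x| <= K * `|x' - x|) ->
  {for x, continuous g}.
Proof.
move=> r0 K0 gK; apply/cvgrPdist_le => e e0.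
have [m m0 mP] : exists2 m, 0 < m & K * m <= e.
  exists (e / (K + 1)); first by rewrite divr_gt0// ltr_wpDl.
  rewrite mulrC -mulrA -[leRHS]mulr1 ler_pM2l// mulrC ler_pdivrMr ?ltr_wpDl//.
  by rewrite mul1r lerDl.
near=> z.
have zr : `|z - x| < Num.min r m.
  by near: z; apply/nbhs_ballP; exists (Num.min r m); rewrite /= ?lt_min ?r0//= => z;
    rewrite /ball/= distrC.
move: zr; rewrite lt_min => /andP[zr zm].
rewrite distrC; apply: le_trans (gK z zr) _; apply: le_trans mP.
by rewrite ler_wpM2l// ltW.
Unshelve. all: by end_near. Qed.

Lemma expands_continuous (F : R -> R -> R) (x y A B : R) : expands F x y A B ->
  {for y, continuous (F x)} /\ {for x, continuous (F^~ y)}.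
Proof.
move=> /(_ 1 ltr01)[r r0 rP]; split.
  apply: (@lipschitz_at_continuous _ _ (`|B| + 1) _ r0); first by rewrite addr_ge0.
  move=> y' yr; have := rP x y'; rewrite subrr normr0 => /(_ r0 yr).
  rewrite mulr0 !add0r mul1r => H.
  rewrite -[X in `|X|](subrK (B * (y' - y))) mulrDl mul1r [leRHS]addrC.
  by apply: le_trans (ler_normD _ _) _; apply: lerD => //; rewrite normrM.
apply: (@lipschitz_at_continuous _ _ (`|A| + 1) _ r0); first by rewrite addr_ge0.
move=> x' xr; have := rP x' y; rewrite subrr normr0 => /(_ xr r0).
rewrite mulr0 !addr0 mul1r => H.
rewrite -[X in `|X|](subrK (A * (x' - x))) mulrDl mul1r [leRHS]addrC.
by apply: le_trans (ler_normD _ _) _; apply: lerD => //; rewrite normrM.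
Qed.

End ComplexAbs.

(** * Comparison of concentric circles, and the maximum principle on a punctured disc *)

Section MeanValue.
Context {R : realType}.

(** A single choice function, so that equal functions get the same primitive: those along [t = 0]
    and [t = pi *+ 2] then coincide. *)
Lemma primitives (a b : R) : a <= b -> exists prim : (R -> R) -> (R -> R),
  forall g : R -> R, {within `[a, b], continuous g} ->
    {within `[a, b], continuous (prim g)} /\
    forall x, x \in `]a, b[ -> is_derive x 1 (prim g) (g x).
Proof.
move=> ab; suff /choice[prim primP] : forall g : R -> R, exists G : R -> R,
    {within `[a, b], continuous g} -> {within `[a, b], continuous G} /\
    forall x, x \in `]a, b[ -> is_derive x 1 G (g x) by exists prim.
move=> g; have [/(primitive_exists ab)[G GP]|nc] := pselect {within `[a, b], continuous g}.
  by exists G.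
by exists g.
Qed.

(** The point c + exp(s + i t). The map is holomorphic in s + i t, so that the Cauchy-Riemann
    equations persist, and a punctured disc becomes a half-plane. *)
Definition polar (c : R[i]) (s t : R) : R[i] :=
  (Re c + expR s * cos t) +i* (Im c + expR s * sin t).

Lemma cabs_polar c s t : cabs (polar c s t - c) = expR s.
Proof.
have -> : polar c s t - c = (expR s)%:C * (cos t +i* sin t).
  case: c => a b; apply/eqP; rewrite eq_complex /=; apply/andP; split; apply/eqP; ring.
rewrite cabsM cabs_real gtr0_norm ?expR_gt0//.
by rewrite /cabs normc_def /= cos2Dsin2 sqrtr1 mulr1.
Qed.

Lemma expands_polar (f : R[i] -> R[i]) c (s t : R) : differentiable f (polar c s t) ->
  exists A B B', expands (fun s t => Re (f (polar c s t))) s t A B /\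
                 expands (fun s t => Im (f (polar c s t))) s t B' A.
Proof.
move=> df.
have eX : expands (fun s t =>
  Re c + expR s * cos t) s t (expR s * cos t) (expR s * - sin t).
  exact/expandsDc/expandsM.
have eY : expands (fun s t => Im c + expR s * sin t) s t (expR s * sin t) (expR s * cos t).
  exact/expandsDc/expandsM.
have [d [dRe dIm]] := @expands_comp _ f (fun s t => Re c + expR s * cos t) (fun s t =>
  Im c + expR s * sin t) _ _ _ _ _ _ df eX eY.
exists (Re (d * (expR s * cos t +i* (expR s * sin t)))),
  (Re (d * (expR s * - sin t +i* (expR s * cos t)))),
  (Im (d * (expR s * cos t +i* (expR s * sin t)))); split => //.
(* The derivative of [polar] in [t] is ['i] times its derivative in [s]. *)
suff -> : Re (d * (expR s * cos t +i* (expR s * sin t)))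
  = Im (d * (expR s * - sin t +i* (expR s * cos t))) by [].
by clear; case: d => x y /=; ring.
Qed.

(** Cauchy's theorem on the rectangle [s0, s1] x [0, 2 pi]: by periodicity the sides [t = 0] and
    [t = pi *+ 2] cancel, so the integrals of the real part over the two circles agree. Each is 2 pi
    times a value on its circle. *)
Lemma circle_Re_eq (f : R[i] -> R[i]) (c : R[i]) (s0 s1 : R) : s0 <= s1 ->
  (forall z, 0 < cabs (z - c) <= expR s1 -> differentiable f z) ->
  exists t0 t1, Re (f (polar c s0 t0)) = Re (f (polar c s1 t1)).
Proof.
move=> s01 df.
pose u s t := Re (f (polar c s t)); pose v s t := Im (f (polar c s t)).
have loc s t : s <= s1 -> exists A B B', expands u s t A B /\ expands v s t B' A.
  by move=> ss; apply/expands_polar/df; rewrite cabs_polar expR_gt0 ler_expR.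
have pi20 : 0 <= pi *+ 2 :> R by rewrite mulrn_wge0// pi_ge0.
have [pU pUP] := primitives pi20; have [pV pVP] := primitives s01.
pose U x := pU (u x); pose V x y := pV (v^~ y) x.
have uc s : s <= s1 -> {within `[0, pi *+ 2], continuous (u s)}.
  move=> ss; apply: continuous_in_subspaceT => t _.
  by have [A [B [B' [/expands_continuous[]]]]] := loc s t ss.
have vc t : {within `[s0, s1], continuous (v^~ t)}.
  apply: continuous_in_subspaceT => s; rewrite inE /= in_itv /= => /andP[_ ss].
  by have [A [B [B' [_ /expands_continuous[]]]]] := loc s t ss.
have V2pi x : V x (pi *+ 2) = V x 0.
  rewrite /V; suff -> : v^~ (pi *+ 2) = v^~ 0 by [].
  by apply/funext => s; rewrite /v /polar cos2pi sin2pi cos0 sin0.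
have ss : s0 + (s1 - s0) = s1 by rewrite addrC subrK.
have md : mixed_diff (fun x y => U x y - V x y) s0 (s0 + (s1 - s0)) 0 (0 + pi *+ 2) = 0.
  apply: (@expands_mixed_diff _ u v); rewrite ?ss ?add0r ?subr_ge0//.
  - move=> x /andP[_ xs].
    by have [? ?] := pUP _ (uc x xs).
  - by move=> y _; have [? ?] := pVP _ (vc y).
  - by move=> x y /andP[_ xs] _; exact: loc.
have incr s : s <= s1 -> exists t, U s (pi *+ 2) - U s 0 = u s t * (pi *+ 2).
  move=> sle; have [Uc Ud] := pUP _ (uc s sle).
  by have [t _ ->] := MVT_segment pi20 Ud Uc; exists t; rewrite subr0.
have [t0 t0P] := incr s0 s01; have [t1 t1P] := incr s1 (lexx _).
exists t0, t1; apply: (@mulIf _ (pi *+ 2)); first by rewrite gt_eqF// mulrn_wgt0// pi_gt0.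
rewrite -/(u s0 t0) -/(u s1 t1) -t0P -t1P.
move: md; rewrite /mixed_diff /= ss add0r !V2pi; clear; lra.
Qed.

(** The inner circle of [circle_Re_eq] is shrunk towards the center. *)
Lemma circle_Re_le (f : R[i] -> R[i]) (c : R[i]) (rho M : R) : 0 < rho ->
  {for c, continuous f} ->
  (forall z, 0 < cabs (z - c) <= rho -> differentiable f z) ->
  (forall z, cabs (z - c) = rho -> Re (f z) <= M) -> Re (f c) <= M.
Proof.
move=> rho0 fc df fM; apply/ler_addgt0Pr => e e0.
have lnr : expR (ln rho) = rho by rewrite lnK// posrE.
have : \forall z \near c, `|f c - f z| <= e%:C.
  by move/cvgrPdist_le : fc; apply; rewrite ltcR.
move=> /nbhs_ballP[r /= r0 rP].
have rE : (Re r)%:C = r by rewrite RRe_real// gtr0_real.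
have r0' : 0 < Re r by rewrite -ltcR rE.
(* The inner circle has radius at most [rho] and at most [Re r / 2]. *)
pose s0 := Num.min (ln rho) (ln (Re r / 2)).
have [|z|t0 [t1 tE]] := @circle_Re_eq f c s0 (ln rho); first by rewrite ge_min lexx.
  by rewrite lnr; exact: df.
have : Re (f c) - Re (f (polar c s0 t0)) <= e.
  have := rP (polar c s0 t0); rewrite /ball /= distrC -rE -!cabsE ltcR lecR cabs_polar.
  have -> : expR s0 < Re r.
    apply: (@le_lt_trans _ _ (expR (ln (Re r / 2))));
      first by rewrite ler_expR ge_min lexx orbT.
    by rewrite lnK ?posrE ?divr_gt0// ltr_pdivrMr// mulr_natr mulr2n ltrDl.
  move=> /(_ isT); apply: le_trans; apply: le_trans (Re_le_cabs _).
  apply: le_trans (ler_norm _); case: (f c) (f (polar c s0 t0)) => [? ?] [? ?].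
  by [].
rewrite tE => H.
have := fM (polar c (ln rho) t1); rewrite cabs_polar lnr => /(_ erefl).
by move: H; clear; lra.
Qed.

(** The rotation by [w] makes the value at the center positive, which reduces to the real part. Mere
    continuity at [c] suits difference quotients and limits at 0. *)
Lemma circle_cabs_le (f : R[i] -> R[i]) (c : R[i]) (rho M : R) : 0 < rho ->
  {for c, continuous f} ->
  (forall z, 0 < cabs (z - c) <= rho -> differentiable f z) ->
  (forall z, cabs (z - c) = rho -> cabs (f z) <= M) -> cabs (f c) <= M.
Proof.
move=> rho0 fc df fM.
have [f0|f0] := eqVneq (f c) 0.
  (* A point of the circle shows that [M] is nonnegative. *)
  have := fM (c + rho%:C); rewrite addrAC subrr add0r cabs_real gtr0_norm// => /(_ erefl).
  by apply: le_trans; rewrite f0 /cabs normr0 cabs_ge0.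
pose w : R[i] := `|f c| / f c.
have w1 : cabs w = 1 by rewrite /cabs normrM normrV ?unitfE// normr_id divff// normr_eq0.
have -> : cabs (f c) = Re (w * f c) by rewrite /w divfK.
apply: (@circle_Re_le (fun z => w * f z) c rho M rho0).
- by apply: (continuousM (s := cst w)); [exact: cst_continuous|exact: fc].
- by move=> z zr; apply: differentiableM; [exact: differentiable_cst|exact: df].
- move=> z zr; apply: le_trans (ler_norm _) _; apply: le_trans (Re_le_cabs _) _.
  by rewrite cabsM w1 mul1r fM.
Qed.

End MeanValue.

(** * Real-valued norms on complex normed spaces *)

Section ComplexNorm.
Context {R : realType} {V : normedModType R[i]}.
Implicit Types x y : V.

Definition cnorm x : R := Re `|x|.

Lemma cnormE x : (cnorm x)%:C = `|x|.
Proof. by rewrite /cnorm RRe_real. Qed.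

Lemma cnorm_ge0 x : 0 <= cnorm x.
Proof. by rewrite -ler0c cnormE. Qed.

Lemma cnormD x y : cnorm (x + y) <= cnorm x + cnorm y.
Proof. by rewrite -lecR rmorphD/= !cnormE ler_normD. Qed.

Lemma cnormN x : cnorm (- x) = cnorm x.
Proof. by rewrite /cnorm normrN. Qed.

Lemma cnormB x y : cnorm (x - y) <= cnorm x + cnorm y.
Proof. by rewrite -(cnormN y); exact: cnormD. Qed.

Lemma cnormZ a x : cnorm (a *: x) = cabs a * cnorm x.
Proof. by apply: complexI; rewrite rmorphM/= cabsE !cnormE normrZ. Qed.

Lemma cnorm_gt0 x : (0 < cnorm x) = (x != 0).
Proof. by rewrite -normr_gt0 -cnormE ltcR. Qed.

Lemma near_cnorm (P : V -> Prop) x : (\forall y \near x, P y) <->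
  exists2 r : R, 0 < r & forall y, cnorm (y - x) < r -> P y.
Proof.
split=> [/nbhs_ballP[r /= r0 rP]|[r r0 rP]].
  have rE : (Re r)%:C = r by rewrite RRe_real// gtr0_real.
  exists (Re r); first by rewrite -ltcR rE.
  move=> y yr; apply: rP.
  by rewrite -ball_normE /= distrC -rE -cnormE ltcR.
apply/nbhs_ballP; exists r%:C; first by rewrite /= ltcR.
by move=> y; rewrite -ball_normE /= distrC -cnormE ltcR => /rP.
Qed.

End ComplexNorm.

Lemma continuous_cnormP {R : realType} {V W : normedModType R[i]} (f : V -> W) x :
  {for x, continuous f} <->
  forall e, 0 < e -> exists2 r, 0 < r & forall y,
    cnorm (y - x) < r -> cnorm (f y - f x) <= e.
Proof.
split=> [/cvgrPdist_le fc e e0|fc].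
  have : \forall y \near x, `|f x - f y| <= e%:C by apply: fc; rewrite ltcR.
  move=> /near_cnorm[r r0 rP]; exists r => // y /rP.
  by rewrite distrC -cnormE lecR.
apply/cvgrPdist_le => e e0; apply/near_cnorm.
have eE : (Re e)%:C = e by rewrite RRe_real// gtr0_real.
have [|r r0 rP] := fc (Re e); first by rewrite -ltcR eE.
by exists r => // y /rP; rewrite distrC -eE -cnormE lecR.
Qed.

(** * Cauchy's estimate for the derivative, and the mean value inequality *)

Section CauchyEstimates.
Context {R : realType}.

Lemma near_eq_differentiable (f g : R[i] -> R[i]) z :
  (\forall w \near z, f w = g w) -> differentiable f z -> differentiable g z.
Proof.
move=> fg /derivable1_diffP df; apply/derivable1_diffP.
by apply: near_eq_derivable df => //; exact: oner_neq0.
Qed.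

(** Maximum principle for the difference quotient of [g] at [c], completed by [d]. On the circle its
    numerator is at most [2 * M]. *)
Lemma cauchy_estimate (g : R[i] -> R[i]) (c d : R[i]) (rho M : R) : 0 < rho ->
  (forall z, cabs (z - c) <= rho -> differentiable g z /\ cabs (g z) <= M) ->
  cderiv g c d -> cabs d <= 2 * M / rho.
Proof.
move=> rho0 gP gd.
have gc : cabs (g c) <= M by have [] // := gP c; rewrite subrr /cabs normr0 ltW.
pose q z := if z == c then d else (g z - g c) / (z - c).
have -> : d = q c by rewrite /q eqxx.
apply: (@circle_cabs_le _ q c rho _ rho0).
- apply/continuous_cnormP => e e0.
  have [r r0 rP] := gd _ e0; exists r => // z zr.
  rewrite {2}/q eqxx /q; case: eqVneq => [_|zc]; first by rewrite subrr /cnorm normr0 ltW.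
  have zc0 : z - c != 0 by rewrite subr_eq0.
  have := rP z zr; have ->
    : g z - g c - d * (z - c) = ((g z - g c) / (z - c) - d) * (z - c) by field.
  by rewrite cabsM ler_pM2r// -[X in is_true X]/(0 < cnorm (z - c)) cnorm_gt0.
- move=> z /andP[zc0 zr].
  have zc : z != c by rewrite -subr_eq0; rewrite -[X in is_true X]cnorm_gt0.
  apply: (@near_eq_differentiable (fun z => (g z - g c) / (z - c))).
    apply/near_cnorm; exists (cabs (z - c)) => // w wz.
    rewrite /q; case: eqVneq => // wc; move: wz; rewrite wc.
    by rewrite -cabsN opprB ltxx.
  have [dg _] := gP z zr.
  apply: differentiableM; first by apply: differentiableB => //; exact: differentiable_cst.
  apply: differentiableV; last by rewrite subr_eq0.
  by apply: differentiableB => //; exact: differentiable_cst.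
- move=> z zr; rewrite /q; case: eqVneq => [zc|zc].
    by move: zr rho0; rewrite zc subrr /cabs normr0 /= => <-; rewrite ltxx.
  have -> : cabs ((g z - g c) / (z - c)) = cabs (g z - g c) / rho.
    by apply: complexI; rewrite rmorphM/= fmorphV/= !cabsE -zr cabsE normrM normfV.
  rewrite ler_pM2r ?invr_gt0//; apply: le_trans (cabsB _ _) _.
  rewrite mulr_natl mulr2n lerD//.
  by have [] := gP z; rewrite ?zr.
Qed.

Lemma expansion_is_derive (h : R -> R) (x d : R) :
  (forall e, 0 < e -> exists2 r, 0 < r & forall y, `|y - x| < r ->
     `|h y - h x - d * (y - x)| <= e * `|y - x|) -> is_derive x 1 h d.
Proof.
move=> hd; have : k^-1 *: (h (k *: 1 + x) - h x) @[k --> 0^'] --> d.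
  apply/cvgrPdist_le => e e0; have [r r0 rP] := hd e e0.
  apply/nbhs_ballP; exists r => // k; rewrite /ball /= sub0r normrN => kr k0.
  have := rP (k + x); rewrite addrK => /(_ kr); rewrite [_ *: 1]mulr1.
  have -> : h (k + x) - h x - d * k = - ((d - k^-1 * (h (k + x) - h x)) * k) by field.
  by rewrite normrN normrM ler_pM2r// normr_gt0.
by move=> hk; apply: DeriveDef; [apply/cvg_ex; exists d|exact/cvg_lim].
Qed.

(** After the rotation that makes [g 1 - g 0] positive, the real mean value theorem applies to the
    real part. *)
Lemma mean_value_ineq (g : R[i] -> R[i]) (L : R) :
  (forall s : R, 0 <= s <= 1 -> exists2 d, cderiv g s%:C d & cabs d <= L) ->
  cabs (g 1 - g 0) <= L.
Proof.
move=> gL.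
have L0 : 0 <= L by have [d _] := gL 0 (introT andP (conj (lexx 0) ler01));
  apply: le_trans; exact: cabs_ge0.
have [->|g10] := eqVneq (g 1 - g 0) 0; first by rewrite /cabs normr0.
pose w : R[i] := `|g 1 - g 0| / (g 1 - g 0).
have w1 : cabs w = 1 by rewrite /cabs normrM normrV ?unitfE// normr_id divff// normr_eq0.
have -> : cabs (g 1 - g 0) = Re (w * g 1) - Re (w * g 0).
  have -> : cabs (g 1 - g 0) = Re (w * (g 1 - g 0)) by rewrite /w divfK.
  by rewrite mulrBr; case: (w * g 1) (w * g 0) => [? ?] [].
pose h (s : R) := Re (w * g s%:C).
have /choice[D DP] : forall s : R, exists d, 0 <= s <= 1 -> is_derive s 1 h d /\ `|d| <= L.
  move=> s; have [/gL[d gd dL]|] := boolP (0 <= s <= 1); last by exists 0.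
  exists (Re (w * d)) => _; split; last first.
    by apply: le_trans (Re_le_cabs _) _; rewrite cabsM w1 mul1r.
  apply: expansion_is_derive => e e0; have [r r0 rP] := gd e e0.
  exists r => // y yr; have yE : cabs (y%:C - s%:C)
    = `|y - s| by rewrite -rmorphB/= cabs_real.
  have := rP y%:C; rewrite yE => /(_ yr); apply: le_trans.
  rewrite -[leRHS]mul1r -w1 -cabsM; apply: le_trans (Re_le_cabs _).
  rewrite /h; case: (w) (d) (g y%:C) (g s%:C) => [? ?] [? ?] [? ?] [? ?] /=.
  by rewrite le_eqVlt; apply/orP; left; apply/eqP; congr `|_|; ring.
have hD (s : R) : s \in `]0, 1[ -> is_derive s 1 h (D s).
  by rewrite in_itv /= => /andP[s0 s1]; have [] // := DP s; rewrite !ltW.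
have hc : {within `[0, 1], continuous h}.
  apply: derivable_within_continuous => s; rewrite in_itv /= => s01.
  by have [? _] := DP s s01; exact: ex_derive.
have [s s01] := MVT_segment ler01 hD hc.
rewrite /h subr0 mulr1 => ->; apply: le_trans (ler_norm _) _.
by have [] := DP s; rewrite ?(itvP s01).
Qed.

End CauchyEstimates.

(** * First and second differences of bounded holomorphic functions *)

Section Lipschitz.
Context {R : realType} {V : normedModType R[i]}.

(** Cauchy's estimate at each point of the segment from [w] to [z], for the restriction of [f] to
    the complex line through them. *)
Lemma holomorphic_lipschitz (f : V -> R[i]) (p : V) (r M : R) : 0 < r ->
  (forall z, cnorm (z - p) < r -> differentiable f z /\ cabs (f z) <= M) ->
  forall z w, cnorm (z - p) < r / 2 -> cnorm (w - p) < r / 2 ->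
    cabs (f z - f w) <= 4 * M / r * cnorm (z - w).
Proof.
move=> r0 fP z w zr wr.
have [->|zw] := eqVneq z w; first by rewrite !subrr /cabs /cnorm !normr0 mulr0.
have zw0 : 0 < cnorm (z - w) by rewrite cnorm_gt0 subr_eq0.
pose l (s : R[i]) := w + s *: (z - w).
(* A parameter radius [rho] is a distance [r / 2] in [V], so that discs centered on the segment stay
   in the ball of radius [r]. *)
pose rho := r / (2 * cnorm (z - w)).
have rho0 : 0 < rho by rewrite divr_gt0// mulr_gt0.
have lP (s : R) (t : R[i]) : 0 <= s <= 1 -> cabs (t - s%:C) <= rho -> cnorm (l t - p) < r.
  move=> /andP[s0 s1] ts.
  have -> : l t - p = ((1 - s)%:C *: (w - p) + s%:C *: (z - p)) + (t - s%:C) *: (z - w).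
    have -> : z - w = (z - p) - (w - p) by rewrite opprB addrA subrK.
    have -> : l t - p = (w - p) + t *: ((z - p) - (w - p)).
      by rewrite /l opprB [z - p + _]addrA subrK addrAC.
    rewrite rmorphB rmorph1; move: (w - p) (z - p) => a b.
    have -> : (1 - s%:C) *: a + s%:C *: b = a + s%:C *: (b - a).
      by rewrite scalerBl scale1r scalerBr -addrA [- _ + _]addrC.
    by rewrite [in RHS]scalerBl -addrA [s%:C *: _ + _]addrC subrK.
  apply: le_lt_trans (cnormD _ _) _; rewrite cnormZ.
  have b2 : cabs (t - s%:C) * cnorm (z - w) <= r / 2.
    apply: (@le_trans _ _ (rho * cnorm (z - w))); first by rewrite ler_pM2r.
    by rewrite /rho le_eqVlt; apply/orP; left; apply/eqP; field; rewrite gt_eqF.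
  have b1 : cnorm ((1 - s)%:C *: (w - p) + s%:C *: (z - p)) < r / 2.
    apply: le_lt_trans (cnormD _ _) _; rewrite !cnormZ !cabs_real !ger0_norm ?subr_ge0//.
    move: (cnorm (w - p)) (cnorm (z - p)) wr zr => a b; move=> ar br.
    apply: (@le_lt_trans _ _ (Num.max a b)); last by rewrite gt_max ar.
    rewrite -[leRHS]mul1r -[X in X * Num.max _ _](subrK s) [leRHS]mulrDl.
    by apply: lerD; apply: ler_wpM2l; rewrite ?subr_ge0// le_max lexx ?orbT.
  by rewrite [ltRHS]splitr ltr_leD.
pose g s := f (l s).
have dl t : differentiable l t.
  apply: differentiableD; first exact: differentiable_cst.
  exact: differentiableZl.
have -> : f z - f w = g 1 - g 0 by rewrite /g /l scale1r scale0r addr0 [w + _]addrC subrK.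
apply: mean_value_ineq => s s01.
have gP t : cabs (t - s%:C) <= rho -> differentiable g t /\ cabs (g t) <= M.
  move=> tr; have [df fM] := fP _ (lP _ _ s01 tr).
  by split=> //; exact: differentiable_comp.
have [|d gd] := @differentiable_cderiv R g s%:C.
  by have [] := gP s%:C; rewrite // subrr /cabs normr0 ltW.
exists d => //; have := cauchy_estimate rho0 gP gd; congr (_ <= _).
by rewrite /rho; field; rewrite !gt_eqF.
Qed.

(** The second difference is a first difference of [h], which is bounded by [4 * M / r * cnorm d]. A
    second Lipschitz estimate, on the ball of radius [r / 4], yields 4 * 4 * 4 = 64. *)
Lemma holomorphic_second_difference (f : V -> R[i]) (p : V) (r M : R) : 0 < r ->
  (forall z, cnorm (z - p) < r -> differentiable f z /\ cabs (f z) <= M) ->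
  forall c d, cnorm (c - p) < r / 16 -> cnorm d < r / 16 ->
    cabs (f (c + d) + f (c - d) - 2 * f c) <= 64 * M / r ^+ 2 * cnorm d ^+ 2.
Proof.
move=> r0 fP c d cr dr.
pose h z := f (z + d) - f z.
have r40 : 0 < r / 4 by rewrite divr_gt0.
have hP z : cnorm (z - p) < r / 4 ->
  differentiable h z /\ cabs (h z) <= 4 * M / r * cnorm d.
  move=> zr; have zd : cnorm (z + d - p) < r / 2.
    by rewrite addrAC; apply: le_lt_trans (cnormD _ _) _; move: zr dr; clear -r0; lra.
  split.
    apply: differentiableB; last by have [] := fP z; rewrite // (lt_trans zr)//;
      clear -r0; lra.
    apply: (@differentiable_comp _ _ _ _ (fun z => z + d) f).
      by apply: differentiableD => //; exact: differentiable_cst.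
    by have [] := fP (z + d); rewrite // (lt_trans zd)//; clear -r0; lra.
  have -> : cnorm d = cnorm (z + d - z) by rewrite addrAC subrr add0r.
  apply: (holomorphic_lipschitz r0 fP) => //.
  by apply: lt_trans zr _; clear -r0; lra.
have -> : f (c + d) + f (c - d) - 2 * f c = h c - h (c - d) by rewrite /h subrK; ring.
have cd : cnorm (c - d - p) < r / 4 / 2.
  by rewrite addrAC; apply: le_lt_trans (cnormB _ _) _; move: cr dr; clear -r0; lra.
have cp : cnorm (c - p) < r / 4 / 2 by apply: lt_trans cr _; clear -r0; lra.
have cdE : c - (c - d) = d by rewrite opprB addrC subrK.
have := holomorphic_lipschitz r40 hP cp cd; rewrite cdE.
by congr (_ <= _); field; rewrite gt_eqF.
Qed.

End Lipschitz.

(** * The formal inverse of a polynomial with constant coefficient 1 *)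

Section InverseSeries.
Context {K : comNzRingType}.
Implicit Types (a : nat -> K) (p Q : {poly K}).

(* [m] is only a recursion bound: [inv_coef_rec a m k] does not depend on it
   when [k <= m]. *)
Fixpoint inv_coef_rec a (m k : nat) : K :=
  match m, k with
  | m'.+1, k'.+1 => - \sum_(j < k'.+1) a j.+1 * inv_coef_rec a m' (k' - j)
  | _, _ => (k == 0%N)%:R
  end.

(* The coefficients of the power series [1 / (1 + a 1 X + a 2 X^2 + ...)]. *)
Definition inv_coef a k := inv_coef_rec a k k.

Lemma inv_coef_recE a m k : (k <= m)%N -> inv_coef_rec a m k = inv_coef a k.
Proof.
have [N] := ubnP k; elim: N k m => // N IH [|k] [|m] //=; rewrite !ltnS => kN km.
rewrite /inv_coef /=; congr (- _); apply: eq_bigr => j _; congr (_ * _).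
have kj : (k - j <= k)%N by exact: leq_subr.
by rewrite !IH ?(leq_trans kj)// (leq_ltn_trans kj).
Qed.

Lemma inv_coef0 a : inv_coef a 0 = 1.
Proof. by []. Qed.

Lemma inv_coefS a k :
  inv_coef a k.+1 = - \sum_(j < k.+1) a j.+1 * inv_coef a (k - j).
Proof.
rewrite {1}/inv_coef /=; congr (- _); apply: eq_bigr => j _.
by rewrite inv_coef_recE// leq_subr.
Qed.

(** The power series is handled only through its truncations, which invert [Q] below the cut. *)
Lemma inv_coef_poly Q N k : Q`_0 = 1 -> (k < N)%N ->
  (Q * \poly_(i < N) inv_coef (nth 0 Q) i)`_k = (k == 0%N)%:R.
Proof.
move=> Q0 kN; rewrite coefM big_ord_recl /= Q0 mul1r subn0 coef_poly kN.
case: k kN => [|k] kN; first by rewrite big_ord0 addr0.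
rewrite inv_coefS /= addrC; apply/eqP; rewrite subr_eq0; apply/eqP.
apply: eq_bigr => j _; rewrite subSS coef_poly (leq_ltn_trans (leq_subr _ _))//.
exact: ltnW.
Qed.

Lemma inv_coef_unique Q p N : Q`_0 = 1 ->
  (forall k, (k < N)%N -> (Q * p)`_k = (k == 0%N)%:R) ->
  forall k, (k < N)%N -> p`_k = inv_coef (nth 0 Q) k.
Proof.
move=> Q0 Qp k; have [M] := ubnP k; elim: M k => // M IH [|k]; rewrite ltnS => kM kN.
  by have := Qp 0%N kN; rewrite coefM big_ord1 Q0 mul1r.
have := Qp k.+1 kN; rewrite coefM big_ord_recl /= Q0 mul1r subn0 => /eqP.
rewrite addr_eq0 => /eqP ->; rewrite inv_coefS; congr (- _); apply: eq_bigr => j _.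
rewrite subSS IH//; first by rewrite (leq_ltn_trans (leq_subr _ _)).
by rewrite (leq_ltn_trans (leq_subr _ _))// ltnW.
Qed.

(** Multiplying the inverse series of the product by [1 - z *: 'X] gives back that of [Q];
    coefficients of degree [k.+1] are compared. *)
Lemma inv_coefM Q z k : Q`_0 = 1 ->
  inv_coef (nth 0 ((1 - z *: 'X) * Q)) k.+1 =
  inv_coef (nth 0 Q) k.+1 + z * inv_coef (nth 0 ((1 - z *: 'X) * Q)) k.
Proof.
move=> Q0; set Q' := _ * Q.
have Q'0 : Q'`_0 = 1 by rewrite coefM big_ord1 coefB coefZ coefX mulr0 subr0 coef1 mul1r.
pose p := \poly_(i < k.+2) inv_coef (nth 0 Q') i.
have : ((1 - z *: 'X) * p)`_k.+1 = inv_coef (nth 0 Q) k.+1.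
  apply: (@inv_coef_unique Q _ k.+2) => // j jk.
  by rewrite mulrCA mulrA; exact: inv_coef_poly.
move=> <-; rewrite mulrBl mul1r coefB -scalerAl coefZ coefXM /= !coef_poly ltnS leqnn.
by rewrite ltnW// subrK.
Qed.

End InverseSeries.

(** * Growth of the inverse series against the location of the zeros *)

Section InverseSeriesBounds.
Context {R : realType}.

Lemma cabs_sum (I : Type) (s : seq I) (P : pred I) (F : I -> R[i]) :
  cabs (\sum_(i <- s | P i) F i) <= \sum_(i <- s | P i) cabs (F i).
Proof.
elim/big_rec2: _ => [|i x y _ xy]; first by rewrite /cabs normr0.
by apply: le_trans (cabsD _ _) _; rewrite lerD2l.
Qed.

Lemma cabsX (z : R[i]) k : cabs (z ^+ k) = cabs z ^+ k.
Proof. by apply: complexI; rewrite rmorphXn/= !cabsE normrX. Qed.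

(** By [inv_coefM], a new factor replaces a coefficient by a sum of [k.+1] earlier ones weighted by
    powers of [z], hence costs one factor [k.+1]. *)
Lemma inv_coef_bound (s : seq R[i]) k : (forall z, z \in s -> cabs z <= 1) ->
  cabs (inv_coef (nth 0 (\prod_(z <- s) (1 - z *: 'X))) k) <= k.+1%:R ^+ size s.
Proof.
elim: s k => [|z s IH] k sP.
  rewrite big_nil expr0; case: k => [|k]; first by rewrite inv_coef0 cabs_real normr1.
  rewrite inv_coefS big1 ?oppr0 ?cabs_real ?normr0// => j _.
  by rewrite coef1 mul0r.
have {}IH j := IH j (fun w ws => sP w (mem_behead (s := z :: s) ws)).
rewrite big_cons; set Q := \prod_(w <- s) _ in IH *.
have Q0 : Q`_0 = 1.
  rewrite -horner_coef0 horner_prod big1 // => w _.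
  by rewrite !hornerE ?mulr0 subr0.
elim: k => [|k IHk]; first by rewrite inv_coef0 cabs_real normr1 expr1n.
rewrite inv_coefM//; apply: le_trans (cabsD _ _) _; rewrite cabsM.
apply: le_trans (lerD (IH k.+1) (_ : _ <= 1 * k.+2%:R ^+ size s * k.+1%:R)) _; last first.
  have e : k.+2%:R = 1 + k.+1%:R :> R by rewrite -natr1 addrC.
  by rewrite mul1r /= exprSr; set B := _ ^+ size s; rewrite e mulrDr mulr1.
rewrite -mulrA; apply: ler_pM; rewrite ?cabs_ge0//; first exact/sP/mem_head.
apply: le_trans IHk _; rewrite /= exprSr ler_wpM2r//.
by rewrite lerXn2r ?nnegrE// ler_nat.
Qed.

(** With [t] the square root of [q], one copy of [t ^+ k] absorbs a factor [k.+1], since (k + 1) t^k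
    <= 1 + t + ... + t^k <= 1 / (1 - t). The other copy is left to the induction. *)
Lemma natX_geometric_bound (m : nat) (q : R) : 0 < q < 1 ->
  exists2 C : R, 0 < C & forall k : nat, k.+1%:R ^+ m * q ^+ k <= C.
Proof.
elim: m q => [|m IH] q /andP[q0 q1].
  by exists 1 => // k; rewrite expr0 mul1r exprn_ile1// ltW.
pose t := Num.sqrt q.
have t0 : 0 < t by rewrite sqrtr_gt0.
have t1 : t < 1 by rewrite -sqrtr1 ltr_sqrt.
have tq : t ^+ 2 = q by rewrite sqr_sqrtr// ltW.
have [C C0 CP] := IH t (introT andP (conj t0 t1)).
have bern (k : nat) : k.+1%:R * t ^+ k <= (1 - t)^-1.
  rewrite -[leRHS]mul1r ler_pdivlMr ?subr_gt0//.
  apply: (@le_trans _ _ ((\sum_(i < k.+1) t ^+ i) * (1 - t))).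
    rewrite ler_pM2r ?subr_gt0//.
    have -> : k.+1%:R = \sum_(i < k.+1) (1 : R) by rewrite sumr_const card_ord.
    rewrite mulr_suml.
    by apply: ler_sum => i _; rewrite mul1r ler_wiXn2l ?(ltW t0) ?(ltW t1)// -ltnS.
  have -> : (\sum_(i < k.+1) t ^+ i) * (1 - t) = 1 - t ^+ k.+1.
    by rewrite -[RHS]opprB subrX1; ring.
  by rewrite gerBl exprn_ge0// ltW.
exists ((1 - t)^-1 * C); first by rewrite mulr_gt0// invr_gt0 subr_gt0.
move=> k; rewrite exprS -tq -exprM mulnC exprM.
have -> : k.+1%:R * k.+1%:R ^+ m * t ^+ k ^+ 2
  = (k.+1%:R * t ^+ k) * (k.+1%:R ^+ m * t ^+ k) by ring.
by apply: ler_pM => //; rewrite mulr_ge0// ?exprn_ge0// ltW.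
Qed.

(** At a zero [x] the product of [Q] and a truncated inverse vanishes. But it is 1 plus terms of
    high degree, which tend to 0 under polynomial growth. *)
Lemma inv_coef_horner_neq0 (Q : {poly R[i]}) (m : nat) (x : R[i]) : Q`_0 = 1 ->
  (forall k, cabs (inv_coef (nth 0 Q) k) <= k.+1%:R ^+ m) ->
  cabs x < 1 -> Q.[x] != 0.
Proof.
move=> Q0 hQ x1; apply/eqP => Qx0.
have [x0|x0] := eqVneq x 0.
  by move: Qx0; rewrite x0 horner_coef0 Q0 => /eqP; rewrite oner_eq0.
(* Of the two factors [q ^+ k] of [r ^+ k], one absorbs the growth and the other still tends to
   0. *)
pose r := cabs x; pose q : R := Num.sqrt r.
have r0 : 0 < r by rewrite -ltcR cabsE normr_gt0.
have q0 : 0 < q by rewrite sqrtr_gt0.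
have q1 : q < 1 by rewrite -sqrtr1 ltr_sqrt.
have qr : q ^+ 2 = r by rewrite sqr_sqrtr// ltW.
have [C C0 CP] := @natX_geometric_bound m q (introT andP (conj q0 q1)).
pose h := inv_coef (nth 0 Q).
have hx k : cabs (h k) * r ^+ k <= C * q ^+ k.
  rewrite -qr -exprM mulnC exprM expr2 mulrA ler_wpM2r ?exprn_ge0 ?(ltW q0)//.
  by apply: le_trans (CP k); rewrite ler_wpM2r ?exprn_ge0 ?(ltW q0).
have Q_neq0 : Q != 0.
  by apply/eqP => Q00; move: Q0; rewrite Q00 coef0 => /esym/eqP; rewrite oner_eq0.
pose n := size Q; pose S := \sum_(j < n) cabs Q`_j.
have S0 : 0 <= S by apply: sumr_ge0 => j _; exact: cabs_ge0.
(* Truncating below degree [N + n] leaves, besides the constant 1, at most [n] terms, each bounded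
   by [S * (C * q ^+ N)]. *)
have small N : 1 <= n%:R * (S * (C * q ^+ N)).
  pose p := \poly_(i < N + n) h i.
  have : (Q * p).[x] = 0 by rewrite hornerM Qx0 mul0r.
  have sz : (size (Q * p)%R <= n + (N + n))%N.
    apply: leq_trans (size_polyMleq _ _) _; apply: leq_trans (leq_pred _) _.
    by rewrite leq_add2l size_poly.
  rewrite (horner_coef_wide _ sz) addnC big_split_ord /=.
  rewrite (eq_bigr (fun i : 'I_(N + n) => (i == 0%N :> nat)%:R)); last first.
    move=> i _; rewrite inv_coef_poly//; case: eqP => [->|_]; first by rewrite mulr1.
    by rewrite mul0r.
  have -> : \sum_(i < N + n) ((i == 0%N :> nat)%:R : R[i]) = 1.
    have Nn : (0 < N + n)%N by rewrite addn_gt0 size_poly_gt0 Q_neq0 orbT.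
    rewrite (bigD1 (Ordinal Nn))//= big1 ?addr0// => i.
    by rewrite -val_eqE /= => /negbTE->.
  move/eqP; rewrite addr_eq0 => /eqP E.
  apply: (@le_trans _ _ (cabs (- \sum_(i < n) (Q * p)`_(N + n + i) * x ^+ (N + n + i)))).
    by rewrite -E cabs_real normr1.
  rewrite cabsN; apply: le_trans (cabs_sum _ _ _) _.
  rewrite [leRHS]mulr_natl -[n in _ *+ n]card_ord -sumr_const.
  apply: ler_sum => i _; set k := (N + n + i)%N.
  have -> : (Q * p)`_k = \sum_(j < n) Q`_j * p`_(k - j).
    rewrite -[Q in LHS]coefK poly_def mulr_suml coef_sum; apply: eq_bigr => j _.
    rewrite -scalerAl coefZ coefXnM ltnNge (_ : (j <= k)%N)//.
    by rewrite ltnW// (leq_trans (ltn_ord j))// /k addnAC leq_addl.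
  rewrite mulr_suml; apply: le_trans (cabs_sum _ _ _) _; rewrite /S mulr_suml.
  apply: ler_sum => j _; rewrite !cabsM cabsX -/r -mulrA ler_wpM2l ?cabs_ge0//.
  have jk : (N <= k - j)%N.
    by rewrite /k -addnA -addnBA ?leq_addr// ltnW// ltn_addr.
  have ph : cabs p`_(k - j) * r ^+ k <= cabs (h (k - j)%N) * r ^+ (k - j).
    have -> : r ^+ k = r ^+ (k - j) * r ^+ j.
      by rewrite -exprD subnK// ltnW// (leq_trans (ltn_ord j))// /k addnAC leq_addl.
    rewrite mulrA -[leRHS]mulr1; apply: ler_pM;
      rewrite ?mulr_ge0 ?cabs_ge0 ?exprn_ge0 ?(ltW r0)//.
      rewrite ler_wpM2r ?exprn_ge0 ?(ltW r0)// coef_poly; case: ifP => // _.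
      by rewrite /cabs normr0 cabs_ge0.
    by rewrite exprn_ile1 ?(ltW r0)// ltW.
  apply: (le_trans ph); apply: le_trans (hx _) _;
    rewrite ler_pM2l// ler_wiXn2l ?(ltW q0)// ltW//.
have := @cvg_geometric R (n%:R * (S * C)) q; rewrite ger0_norm ?(ltW q0)// => /(_ q1).
move=> /cvgrPdist_lt/(_ _ ltr01)[N _ /(_ N (leqnn _))]; rewrite /= sub0r normrN.
have := small N; rewrite !mulrA => H; rewrite ltNge => /negP; apply.
exact: le_trans H (ler_norm _).
Qed.

End InverseSeriesBounds.

(** * Reversed polynomials of points of the polydisc *)

Section RootPoly.
Context {R : realType} {n : nat}.
Implicit Types v : 'rV[R[i]]_n.

(* The reversed polynomial: its roots are the inverses of the [v 0 j != 0]. *)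
Definition root_poly v : {poly R[i]} := \prod_(j < n) (1 - v 0 j *: 'X).

Lemma coef_root_poly v k : (root_poly v)`_k = (-1) ^+ k * elem_sym k v.
Proof.
rewrite /root_poly; under eq_bigr => j _ do rewrite addrC -scaleNr.
rewrite bigA_distr coef_sum /elem_sym mulr_sumr [RHS]big_mkcond /=.
apply: eq_bigr => J _; rewrite -big_mkcond /= scaler_prod prodr_const coefZ coefXn.
by rewrite prodrN eq_sym; case: eqP => [->|_]; rewrite ?mulr1 ?mulr0.
Qed.

(** The point lists the inverses of the roots of [Q], completed by zeros, whose factors are 1. *)
Lemma root_poly_exists (Q : {poly R[i]}) : Q`_0 = 1 -> (size Q <= n.+1)%N ->
  (forall x, root Q x -> 1 < cabs x) ->
  exists2 v, polydisc R n v & root_poly v = Q.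
Proof.
move=> Q0 sQ rQ; have [r Qr] := closed_field_poly_normal Q.
have Q_neq0 : Q != 0.
  by apply/eqP => Q00; move: Q0; rewrite Q00 coef0 => /esym/eqP; rewrite oner_eq0.
have rP z : z \in r -> 1 < cabs z.
  move=> zr; apply: rQ; rewrite Qr rootE hornerZ mulf_eq0; apply/orP; right.
  by rewrite -rootE root_prod_XsubC.
have r0 z : z \in r -> z != 0.
  move=> /rP z1; apply: contraTneq z1 => ->.
  by rewrite /cabs normr0 -leNgt ler01.
pose s := [seq z^-1 | z <- r].
have Qs : Q = \prod_(z <- s) (1 - z *: 'X).
  have E : \prod_(z <- r) ('X - z%:P)
    = (\prod_(z <- r) - z) *: \prod_(z <- s) (1 - z *: 'X).
    rewrite big_map -scaler_prod big_seq [RHS]big_seq; apply: eq_bigr => z /r0 z0.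
    by rewrite scalerBr scalerA mulNr divff// scaleN1r opprK alg_polyC polyCN addrC.
  move: Q0; rewrite Qr E scalerA coefZ -horner_coef0 horner_prod [X in _ * X]big1 => [|z _].
    by rewrite mulr1 => ->; rewrite scale1r.
  by rewrite !hornerE ?mulr0 subr0.
have ss : (size s <= n)%N.
  rewrite size_map -ltnS -(size_prod_XsubC r id) (leq_trans _ sQ)//.
  by rewrite Qr size_scale// lead_coef_eq0.
exists (\row_j nth 0 s j).
  move=> j; rewrite mxE; have [js|js] := ltnP j (size s); last first.
    by rewrite nth_default// normr0.
  have /mapP[z zr ->] : nth 0 s j \in s by exact: mem_nth.
  rewrite normfV invf_lt1 ?normr_gt0 ?r0//.
  by rewrite -cabsE -[1]/(1%:C) ltcR rP.
rewrite Qs (big_nth 0) big_mkord /root_poly.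
under eq_bigr => j _ do rewrite mxE.
rewrite (big_ord_widen n (fun j : nat => 1 - nth 0 s j *: 'X) ss) [RHS]big_mkcond.
apply: eq_bigr => j _; case: ltnP => //= js.
by rewrite nth_default// scale0r subr0.
Qed.

End RootPoly.

(** * Pairs of trinomials whose average has a zero in the disc *)

Section Trinomials.
Context {R : realType}.
Implicit Types (a b : R[i]).

Definition trinomial a b (l m : nat) : {poly R[i]} := 1 + a *: 'X^l + b *: 'X^m.

Lemma horner_trinomial a b l m x : (trinomial a b l m).[x] = 1 + a * x ^+ l + b * x ^+ m.
Proof. by rewrite /trinomial !hornerE. Qed.

Lemma size_trinomial a b l m : (0 < l)%N -> (l < m)%N ->
  (size (trinomial a b l m) <= m.+1)%N.
Proof.
move=> l0 lm; rewrite (leq_trans (size_polyD _ _))// geq_max; apply/andP; split.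
  rewrite (leq_trans (size_polyD _ _))// geq_max size_poly1 /=.
  by rewrite (leq_trans (size_scale_leq _ _))// size_polyXn ltnS ltnW.
by rewrite (leq_trans (size_scale_leq _ _))// size_polyXn.
Qed.

Lemma coef_trinomial a b l m k : (trinomial a b l m)`_k =
  (k == 0%N)%:R + a * (k == l)%:R + b * (k == m)%:R.
Proof. by rewrite /trinomial !coefD coef1 !coefZ !coefXn. Qed.

(** The discriminant is negative, so the roots are conjugate, with product [alpha^-1 >= 1]. *)
Lemma quadratic_root_ge1 (alpha beta : R) (w : R[i]) : 0 < alpha <= 1 ->
  beta ^+ 2 < 4 * alpha -> 1 + beta%:C * w + alpha%:C * w ^+ 2 = 0 -> 1 <= cabs w.
Proof.
move=> /andP[a0 a1] disc; case: w => x y; rewrite expr2 => /eqP; rewrite eq_complex /=.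
rewrite !mul0r !subr0 !addr0 !add0r => /andP[/eqP re /eqP im].
have im' : y * (beta + 2 * alpha * x) = 0 by rewrite -[RHS]im; ring.
move/eqP: im'; rewrite mulf_eq0 => /orP[/eqP y0|/eqP bx].
  have : (2 * alpha * x + beta) ^+ 2 = beta ^+ 2 - 4 * alpha.
    have -> : (2 * alpha * x + beta) ^+ 2
      = 4 * alpha * (1 + beta * x + alpha * (x * x - y * y)) + beta ^+ 2 - 4 * alpha.
      by rewrite y0; ring.
    by rewrite re mulr0 add0r.
  by have := sqr_ge0 (2 * alpha * x + beta); move: disc; clear; lra.
have xy : alpha * (x ^+ 2 + y ^+ 2) = 1.
  have -> : alpha * (x ^+ 2 + y ^+ 2)
    = 1 - (1 + beta * x + alpha * (x * x - y * y)) + x * (beta + 2 * alpha * x) by ring.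
  by rewrite re bx mulr0 subr0 addr0.
rewrite /cabs normc_def /= -sqrtr1 ler_wsqrtr// -xy ler_piMl//.
by rewrite addr_ge0// sqr_ge0.
Qed.

(** With w = u y the left side is (1 + 2w/3)(1 - 2w/3 + w^2), where the linear factor vanishes at
    -3/2. *)
Lemma cubic_root_ge1 (u y : R[i]) : cabs u = 1 ->
  1 + ((5 / 9)%:C * u ^+ 2) * y ^+ 2 + ((2 / 3)%:C * u ^+ 3) * y ^+ 3 = 0 -> 1 <= cabs y.
Proof.
move=> u1 y0; have -> : cabs y = cabs (u * y) by rewrite cabsM u1 mul1r.
have : (1 + (2 / 3) * (u * y)) * (1 + (- (2 / 3))%:C * (u * y) + 1%:C * (u * y) ^+ 2) = 0.
  by rewrite -[RHS]y0 rmorphN !rmorphM !fmorphV !rmorph_nat rmorph1; field;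
    rewrite ?pnatr_eq0.
move=> /eqP; rewrite mulf_eq0 => /orP[/eqP w0|/eqP w0].
  have : u * y = (- (3 / 2))%:C.
    have -> : u * y = (1 + (2 / 3) * (u * y)) * (3 / 2) - 3 / 2 by field.
    by rewrite w0 mul0r sub0r rmorphN rmorphM fmorphV !rmorph_nat.
  by move->; rewrite cabs_real normrN ger0_norm; clear; lra.
by apply: quadratic_root_ge1 w0; clear; lra.
Qed.

(** With w = u y the left side is (1 - 7w/6 + w^2)(1 + 7w/6 + 13w^2/36), where both discriminants
    are negative. *)
Lemma quartic_root_ge1 (u y : R[i]) : cabs u = 1 ->
  1 + ((161 / 216)%:C * u ^+ 3) * y ^+ 3 + ((13 / 36)%:C * u ^+ 4) * y ^+ 4 = 0 ->
    1 <= cabs y.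
Proof.
move=> u1 y0; have -> : cabs y = cabs (u * y) by rewrite cabsM u1 mul1r.
have : (1 + (- (7 / 6))%:C * (u * y) + 1%:C * (u * y) ^+ 2) * (1 + (7 / 6)%:C * (u * y)
  + (13 / 36)%:C * (u * y) ^+ 2) = 0.
  by rewrite -[RHS]y0 rmorphN !rmorphM !fmorphV !rmorph_nat rmorph1; field;
    rewrite ?pnatr_eq0.
by move=> /eqP; rewrite mulf_eq0 => /orP[/eqP w0|/eqP w0]; apply: quadratic_root_ge1 w0;
  clear; lra.
Qed.

(** Substitution of (kappa x)^q for [y]: the contraction pushes the zeros strictly outside the
    closed disc. *)
Lemma trinomial_scaled_roots a b (kappa : R) (q l m : nat) : 0 < kappa < 1 ->
  (0 < q)%N ->
  (forall y, 1 + a * y ^+ l + b * y ^+ m = 0 -> 1 <= cabs y) ->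
  forall x, root (trinomial (a * kappa%:C ^+ (q * l)) (b * kappa%:C ^+ (q * m)) (q
    * l) (q * m)) x ->
    1 < cabs x.
Proof.
move=> /andP[k0 k1] q0 ab x /rootP; rewrite horner_trinomial.
rewrite -!mulrA -!exprMn !exprM => /ab; rewrite cabsX cabsM cabs_real gtr0_norm//.
rewrite -[X in X <= _](expr1n _ q) ler_pXn2r ?nnegrE ?mulr_ge0 ?cabs_ge0 ?(ltW k0)//.
move=> kx; apply: lt_le_trans (_ : kappa^-1 <= _); first by rewrite invf_gt1.
by rewrite -[_^-1]mulr1 ler_pdivrMl.
Qed.

(** The zero [x] is the inverse of a root of the averaged polynomial, which thus lies outside the
    closed disc. The sum of the reversed polynomials has the same zeros as their average. *)
Definition midpoint_witness (n : nat) : Prop := exists (v1 v2 : 'rV[R[i]]_n) (x : R[i]),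
  [/\ polydisc R n v1, polydisc R n v2,
      (forall k, (0 < k)%N -> (k.*2 <= n)%N -> elem_sym k v1 = 0 /\ elem_sym k v2 = 0),
      cabs x < 1 & (root_poly v1 + root_poly v2).[x] = 0].

(** The average with coefficients [A], [B] is 1 at 0 and negative at 1, hence vanishes at some [t]
    in between. Contracting both trinomials by [kappa] moves their zeros off the unit circle and [t]
    to [t / kappa]. *)
Lemma trinomial_midpoint_witness (n q l m : nat) (a1 b1 a2 b2 : R[i]) (A B : R) :
  (0 < q)%N -> (0 < l < m)%N -> (q * m <= n)%N -> (n < (q * l).*2)%N ->
  (forall y, 1 + a1 * y ^+ l + b1 * y ^+ m = 0 -> 1 <= cabs y) ->
  (forall y, 1 + a2 * y ^+ l + b2 * y ^+ m = 0 -> 1 <= cabs y) ->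
  a1 + a2 = (2 * A)%:C -> b1 + b2 = (2 * B)%:C -> 1 + A + B < 0 -> midpoint_witness n.
Proof.
move=> q0 /andP[l0 lm] qmn nql r1 r2 aA bB AB.
have ql0 : (0 < q * l)%N by rewrite muln_gt0 q0.
have qlm : (q * l < q * m)%N by rewrite ltn_pmul2l.
have [t t01 tP] : exists2 t : R, 0 < t < 1 & 1 + A * t ^+ (q * l) + B * t ^+ (q * m) = 0.
  pose p : {poly R} := - (1 + A *: 'X^(q * l) + B *: 'X^(q * m)).
  have pE x : p.[x] = - (1 + A * x ^+ (q * l) + B * x ^+ (q * m)) by rewrite /p !hornerE.
  have p0 : p.[0] = -1 by rewrite pE !expr0n !gtn_eqF// ?(ltn_trans ql0)// !mulr0 !addr0.
  have p1 : 0 < p.[1] by rewrite pE !expr1n !mulr1 oppr_gt0.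
  have [|t /andP[t0 t1] /rootP pt] := @poly_ivt R p 0 1 ler01;
    first by rewrite p0 lerN10 ltW.
  exists t.
    apply/andP; split; rewrite lt_neqAle ?t0 ?t1 andbT; apply/eqP => te.
      by move/eqP: pt; rewrite -te p0 oppr_eq0 oner_eq0.
    by move: p1; rewrite -te pt ltxx.
  by apply/eqP; rewrite -oppr_eq0 -pE pt.
(* Midway between [t] and 1, so that [t / kappa] is still less than 1. *)
move: t01 => /andP[t0 t1]; pose kappa := (1 + t) / 2.
have k01 : 0 < kappa < 1 by rewrite /kappa; apply/andP; move: t0 t1; clear; split; lra.
have tk : t < kappa by rewrite /kappa; move: t1; clear; lra.
have /andP[k0 k1] := k01.
have build a b : (forall y, 1 + a * y ^+ l + b * y ^+ m = 0 -> 1 <= cabs y) ->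
    exists2 v : 'rV[R[i]]_n, polydisc R n v &
      root_poly v = trinomial (a * kappa%:C ^+ (q * l)) (b * kappa%:C ^+ (q * m)) (q
        * l) (q * m).
  move=> ab; apply: root_poly_exists.
  - by rewrite coef_trinomial eqxx (ltn_eqF ql0) (ltn_eqF (ltn_trans ql0 qlm)) /= !mulr0
    !addr0.
  - by rewrite (leq_trans (size_trinomial _ _ _ _)).
  - exact: trinomial_scaled_roots.
have [v1 v1d v1E] := build _ _ r1; have [v2 v2d v2E] := build _ _ r2.
have zero a b (v : 'rV[R[i]]_n) k : root_poly v = trinomial a b (q * l) (q * m) ->
    (0 < k)%N -> (k.*2 <= n)%N -> elem_sym k v = 0.
  move=> vE k_gt0 kn; have kql : (k < q * l)%N by rewrite -ltn_double (leq_ltn_trans kn).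
  have : (root_poly v)`_k = 0.
    by rewrite vE coef_trinomial (gtn_eqF k_gt0) (ltn_eqF kql) (ltn_eqF (ltn_trans kql
      qlm)) /= !mulr0 !addr0.
  by rewrite coef_root_poly => /eqP; rewrite mulf_eq0 signr_eq0 /= => /eqP.
exists v1, v2, (t / kappa)%:C; split => //.
- by move=> k k_gt0 kn; split; [exact: zero v1E _ _|exact: zero v2E _ _].
- have x0 : 0 <= t / kappa by rewrite divr_ge0// ltW.
  by rewrite cabs_real ger0_norm// ltr_pdivrMr// mul1r.
rewrite hornerD v1E v2E !horner_trinomial.
have e k : kappa%:C ^+ k * (t / kappa)%:C ^+ k = (t ^+ k)%:C.
  by rewrite -exprMn -rmorphM -rmorphXn /= mulrCA divff ?mulr1// gt_eqF.
rewrite -!(mulrA a1) -!(mulrA b1) -!(mulrA a2) -!(mulrA b2) !e.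
transitivity (2 + (a1 + a2) * (t ^+ (q * l))%:C + (b1 + b2) * (t ^+ (q * m))%:C);
  first by ring.
rewrite aA bB; transitivity (2 * (1 + A * t ^+ (q * l) + B * t ^+ (q * m)))%:C.
  by rewrite -[2 in LHS](rmorph_nat (real_complex R)) -!rmorphM -!rmorphD /=;
    congr (_%:C); ring.
by rewrite tP mulr0.
Qed.

Lemma cabs_pythagorean (x y : R) : x ^+ 2 + y ^+ 2 = 1 -> cabs (x +i* y) = 1.
Proof. by move=> xy; rewrite /cabs normc_def /= xy sqrtr1. Qed.

(* The two (reversed) trinomials arise from one with real coefficients by
   rotations through opposite angles; their average is real and negative at 1,
   hence vanishes in ]0, 1[. The degrees of the nonzero coefficients, [2q] and
   [3q] for the cubic, [3q] and [4q] for the quartic, must lie between n/2 and n: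
   neither family covers all n. *)
Lemma exists_midpoint_witness n : (3 <= n)%N -> midpoint_witness n.
Proof.
move=> n3.
have cubic q : (0 < q)%N -> (q * 3 <= n)%N -> (n < (q * 2).*2)%N -> midpoint_witness n.
  move=> q0 qn nq.
  (* The Pythagorean triple 5, 12, 13 gives a rational point of the unit circle whose square and
     cube have real parts -119/169 and -2035/2197; [u2] is its conjugate. *)
  pose u1 : R[i] := (5 / 13) +i* (12 / 13); pose u2 : R[i] := (5 / 13) +i* (- (12 / 13)).
  apply: (@trinomial_midpoint_witness n q 2 3 ((5 / 9)%:C * u1 ^+ 2) ((2 / 3)%:C * u1 ^+ 3)
    ((5 / 9)%:C * u2 ^+ 2) ((2 / 3)%:C * u2 ^+ 3) (5 / 9 * (- (119 / 169))) (2 / 3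
      * (- (2035 / 2197))) q0 isT qn nq).
  - by move=> y; apply: cubic_root_ge1; apply: cabs_pythagorean; field.
  - by move=> y; apply: cubic_root_ge1; apply: cabs_pythagorean; field.
  - by apply/eqP; rewrite eq_complex !exprS expr0 mulr1 /=; apply/andP; split; apply/eqP;
    field.
  - by apply/eqP; rewrite eq_complex !exprS expr0 mulr1 /=; apply/andP; split; apply/eqP;
    field.
  - by clear; lra.
have quartic q : (0 < q)%N -> (q * 4 <= n)%N -> (n < (q * 3).*2)%N -> midpoint_witness n.
  move=> q0 qn nq.
  (* Here the third and fourth powers have real parts -117/125 and -527/625. *)
  pose u1 : R[i] := (3 / 5) +i* (4 / 5); pose u2 : R[i] := (3 / 5) +i* (- (4 / 5)).
  apply: (@trinomial_midpoint_witness n q 3 4 ((161 / 216)%:C * u1 ^+ 3) ((13 / 36)%:C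
    * u1 ^+ 4)
    ((161 / 216)%:C * u2 ^+ 3) ((13 / 36)%:C * u2 ^+ 4) (161 / 216
      * (- (117 / 125))) (13 / 36 * (- (527 / 625))) q0 isT qn nq).
  - by move=> y; apply: quartic_root_ge1; apply: cabs_pythagorean; field.
  - by move=> y; apply: quartic_root_ge1; apply: cabs_pythagorean; field.
  - by apply/eqP; rewrite eq_complex !exprS expr0 mulr1 /=; apply/andP; split; apply/eqP;
    field.
  - by apply/eqP; rewrite eq_complex !exprS expr0 mulr1 /=; apply/andP; split; apply/eqP;
    field.
  - by clear; lra.
(* For q = n %/ 3 >= 3 one has 3q <= n < 3q + 3 <= 4q. *)
have [n9|n9] := leqP 9 n.
  by apply: (cubic (n %/ 3)%N); lia.
have : (n = 3 \/ n = 4 \/ n = 5 \/ n = 6 \/ n = 7 \/ n = 8)%N by lia.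
case=> [|[|[|[|[|]]]]] nE.
- by apply: (cubic 1); rewrite ?nE.
- by apply: (quartic 1); rewrite ?nE.
- by apply: (quartic 1); rewrite ?nE.
- by apply: (cubic 2); rewrite ?nE.
- by apply: (cubic 2); rewrite ?nE.
- by apply: (quartic 2); rewrite ?nE.
Qed.

End Trinomials.

(** * Coordinates in C^n, and compactness of the closed disc *)

Section RowSpace.
Context {R : realType}.

Lemma coord_le_cnorm n (x : 'rV[R[i]]_n) j : cabs (x 0 j) <= cnorm x.
Proof.
rewrite -lecR cabsE cnormE (_ : `|x| = mx_norm x)// mx_normE [_ <= _%:num]num_le.
exact: (le_bigmax _ (fun i : 'I_1 * 'I_n => `|x i.1 i.2|%:nng) (0, j)).
Qed.

Lemma cnorm_row_le n (x : 'rV[R[i]]_n) B : 0 <= B ->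
  (forall j, cabs (x 0 j) <= B) -> cnorm x <= B.
Proof.
move=> B0 xB; rewrite -lecR cnormE (_ : `|x| = mx_norm x)//.
have [->|/mx_norm_neq0[[i j] ->]] := eqVneq (mx_norm x) 0; first by rewrite ler0c.
by rewrite /= ord1 -cabsE lecR.
Qed.

Lemma differentiable_row (V : normedModType R[i]) n (f : V -> 'rV[R[i]]_n) x :
  (forall j, differentiable (fun z => f z 0 j) x) -> differentiable f x.
Proof.
move=> df.
have -> : f = \sum_(j < n) (fun z => f z 0 j *: (delta_mx 0 j : 'rV[R[i]]_n)).
  by apply/funext => z; rewrite fct_sumE {1}[f z]row_sum_delta.
by apply: differentiable_sum => j; exact: differentiableZl.
Qed.

Lemma differentiable_row_coord (V : normedModType R[i]) n (f : V -> 'rV[R[i]]_n) x j :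
  differentiable f x -> differentiable (fun z => f z 0 j) x.
Proof.
move=> df; apply: (@differentiable_comp _ _ _ _ f (fun y : 'rV[R[i]]_n => y 0 j)) => //.
exact: differentiable_coord.
Qed.

(** Transported from the real plane, where the disc is a closed part of a square. *)
Lemma compact_disc : compact [set z : R[i] | cabs z <= 1].
Proof.
pose S := [set p : R * R | p.1 ^+ 2 + p.2 ^+ 2 <= 1].
pose g (p : R * R) : R[i] := p.1 +i* p.2.
have gc : continuous g.
  move=> p; apply/cvgrPdist_le => e e0.
  have eE : (Re e)%:C = e by rewrite RRe_real// gtr0_real.
  have e0' : 0 < Re e / 2 by rewrite divr_gt0// -ltcR eE.
  have /cvgrPdist_le/(_ _ e0') c1 : q.1 @[q --> p] --> p.1 by exact: cvg_fst.
  have /cvgrPdist_le/(_ _ e0') c2 : q.2 @[q --> p] --> p.2 by exact: cvg_snd.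
  near=> q.
  rewrite -eE -cabsE lecR; apply: le_trans (cabs_le _) _.
  rewrite (_ : Re (g p - g q) = p.1 - q.1)// (_ : Im (g p - g q) = p.2 - q.2)//.
  by rewrite [leRHS]splitr; apply: lerD; near: q; [exact: c1|exact: c2].
have -> : [set z : R[i] | cabs z <= 1] = g @` S.
  apply/seteqP; split=> [[x y]|_ [[x y] /= xy <-]] /=.
    rewrite /cabs normc_def /= -sqrtr1 ler_sqrt// => xy.
    by exists (x, y).
  by rewrite /cabs normc_def /= -sqrtr1 ler_sqrt.
apply: continuous_compact; first exact: continuous_subspaceT.
pose Q : set R := [set` `[-1, 1]].
apply: (subclosed_compact (B := Q `*` Q)).
- rewrite (_ : S = (fun p : R * R => p.1 * p.1 + p.2 * p.2) @^-1` [set x | x <= 1])//.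
  apply: closed_comp; last exact: closed_le.
  move=> p _; apply: (cvgD (f := fun q : R * R => q.1 * q.1) (g := fun q : R * R =>
    q.2 * q.2)).
    by apply: cvgM; exact: cvg_fst.
  by apply: cvgM; exact: cvg_snd.
- by apply: compact_setX; exact: segment_compact.
have sq (a b : R) : a ^+ 2 + b ^+ 2 <= 1 -> a \in `[-1, 1].
  move=> ab; rewrite in_itv /= -ler_norml -(@ler_pXn2r _ 2)// ?nnegrE// expr1n.
  by rewrite real_normK ?num_real//; apply: le_trans ab; rewrite lerDl sqr_ge0.
by move=> [x y] xy; split; [exact: sq xy|apply: (sq _ x); rewrite addrC].
Unshelve. all: by end_near. Qed.

End RowSpace.

(** * Weighted dilations and inverse series on the symmetrized polydisc *)

Section Symmetrization.
Context {R : realType} {n : nat}.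
Implicit Types v : 'rV[R[i]]_n.

Lemma elem_symZ (l : R[i]) k v : elem_sym k (l *: v) = l ^+ k * elem_sym k v.
Proof.
rewrite /elem_sym mulr_sumr; apply: eq_bigr => J /eqP Jk.
under eq_bigr => j _ do rewrite mxE.
by rewrite big_split /= prodr_const Jk.
Qed.

Lemma sigmaZ_coord (l : R[i]) v k : sigma (l *: v) 0 k = l ^+ k.+1 * elem_sym k.+1 v.
Proof. by rewrite mxE elem_symZ. Qed.

Lemma differentiable_sigmaZ v l : differentiable (fun l : R[i] => sigma (l *: v)) l.
Proof.
apply: differentiable_row => k.
have -> : (fun l : R[i] => sigma (l *: v) 0 k) = (fun l => l ^+ k.+1 * elem_sym k.+1 v).
  by apply/funext => z; exact: sigmaZ_coord.
apply: differentiableM; last exact: differentiable_cst.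
by apply/derivable1_diffP; exact: exprn_derivable.
Qed.

Lemma polydiscZ (l : R[i]) v : cabs l <= 1 -> polydisc R n v -> polydisc R n (l *: v).
Proof.
move=> l1 vD j; rewrite mxE normrM -cabsE; apply: le_lt_trans (vD j).
by rewrite ler_piMl// -[1]/(1%:C) lecR.
Qed.

Lemma elem_sym_gt k v : (n < k)%N -> elem_sym k v = 0.
Proof.
move=> nk; rewrite /elem_sym big_pred0// => J; apply/eqP => Jk.
by have := max_card (mem J); rewrite card_ord Jk leqNgt nk.
Qed.

(* The coefficient of degree [j] of the polynomial that [root_poly] attaches to
   any preimage of [x] under [sigma]. *)
Definition sigma_coef (x : 'rV[R[i]]_n) (j : nat) : R[i] :=
  if j is j'.+1 then (-1) ^+ j * (if insub j' is Some k then x 0 k else 0) else 1.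

Lemma sigma_coefE v : sigma_coef (sigma v) = nth 0 (root_poly v).
Proof.
apply/funext => -[|j] /=; rewrite coef_root_poly.
  rewrite /elem_sym (big_pred1 finset.set0); last by move=> J; rewrite /= finset.cards_eq0.
  by rewrite finset.big_set0 mulr1.
case: insubP => [k _ <-|]; first by rewrite mxE.
by rewrite -leqNgt => nj; rewrite elem_sym_gt.
Qed.

Lemma inv_coef_root_poly v k : (forall j, cabs (v 0 j) <= 1) ->
  cabs (inv_coef (nth 0 (root_poly v)) k) <= k.+1%:R ^+ n.
Proof.
move=> vD; pose s := [seq v 0 j | j <- enum 'I_n].
have -> : root_poly v = \prod_(z <- s) (1 - z *: 'X) by rewrite big_map big_enum.
rewrite -[n in _ ^+ n](card_ord n) cardE -(size_map (fun j => v 0 j)).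
by apply: inv_coef_bound => _ /mapP[j _ ->].
Qed.

End Symmetrization.

(** * Functions on the unit disc to which the maximum principle applies *)

Section HolomorphicOff0.
Context {R : realType}.

(* The regularity that [circle_cabs_le] requires on the unit disc. *)
Definition holomorphic_off0 (h : R[i] -> R[i]) : Prop :=
  {for 0, continuous h} /\ forall z, 0 < cabs z <= 1 -> differentiable h z.

Lemma holomorphic_off0_cst a : holomorphic_off0 (fun=> a).
Proof. by split=> [|z _]; [exact: cst_continuous|exact: differentiable_cst]. Qed.

Lemma holomorphic_off0D f g : holomorphic_off0 f -> holomorphic_off0 g ->
  holomorphic_off0 (fun z => f z + g z).
Proof.
move=> [fc fd] [gc gd]; split; first exact: (continuousD fc gc).
by move=> z z01; apply: differentiableD; [exact: fd|exact: gd].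
Qed.

Lemma holomorphic_off0M f g : holomorphic_off0 f -> holomorphic_off0 g ->
  holomorphic_off0 (fun z => f z * g z).
Proof.
move=> [fc fd] [gc gd]; split; first exact: (continuousM fc gc).
by move=> z z01; apply: differentiableM; [exact: fd|exact: gd].
Qed.

Lemma holomorphic_off0_sum m (F : nat -> R[i] -> R[i]) :
  (forall j, holomorphic_off0 (F j)) -> holomorphic_off0 (fun z => \sum_(j < m) F j z).
Proof.
move=> hF; elim: m => [|m IH].
  under eq_fun do rewrite big_ord0; exact: holomorphic_off0_cst.
by under eq_fun do rewrite big_ord_recr; exact: holomorphic_off0D.
Qed.

(** By its recursion [inv_coef] is a polynomial in the [a z j], so closure under sums and products
    suffices. *)
Lemma holomorphic_off0_inv_coef (a : R[i] -> nat -> R[i]) k :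
  (forall j, holomorphic_off0 (a^~ j)) -> holomorphic_off0 (fun z => inv_coef (a z) k).
Proof.
move=> ha; suff : forall m k, holomorphic_off0 (fun z => inv_coef_rec (a z) m k) by apply.
elim=> [|m IH] [|k'] /=; try exact: holomorphic_off0_cst.
under eq_fun do rewrite -mulN1r.
apply: holomorphic_off0M; first exact: holomorphic_off0_cst.
apply: (@holomorphic_off0_sum _ (fun j z => a z j.+1 * inv_coef_rec (a z) m (k' - j))).
by move=> j; apply: holomorphic_off0M.
Qed.

End HolomorphicOff0.

(** * Local estimates for maps into C^n, and pulled-back midpoints *)

Section LocalEstimates.
Context {R : realType} {V : normedModType R[i]}.

Lemma holomorphic_local_bound (W : normedModType R[i]) (D : set V) (f : V -> W) p :
  open D -> holomorphic_on D f -> D p ->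
  exists r M : R, 0 < r /\ forall z, cnorm (z - p) < r ->
    [/\ D z, differentiable f z & cnorm (f z) <= M].
Proof.
move=> oD hf Dp.
have /near_cnorm[r1 r10 r1D] : \forall z \near p, D z by exact: open_nbhs_nbhs.
have /continuous_cnormP/(_ _ ltr01)[r2 r20 r2f] : {for p, continuous f}.
  exact/differentiable_continuous/hf.
exists (Num.min r1 r2), (cnorm (f p) + 1); split; first by rewrite lt_min r10.
move=> z; rewrite lt_min => /andP[/r1D Dz /r2f fz]; split=> //; first exact: hf.
by rewrite -[f z](subrK (f p)) addrC; apply: le_trans (cnormD _ _) _; rewrite lerD2l.
Qed.

Lemma row_lipschitz n (f : V -> 'rV[R[i]]_n) p (r M : R) : 0 < r ->
  (forall z, cnorm (z - p) < r -> differentiable f z /\ cnorm (f z) <= M) ->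
  forall z w, cnorm (z - p) < r / 2 -> cnorm (w - p) < r / 2 ->
    cnorm (f z - f w) <= 4 * M / r * cnorm (z - w).
Proof.
move=> r0 fP z w zr wr.
have M0 : 0 <= M.
  have [|_] := fP p; first by rewrite subrr /cnorm normr0.
  exact: le_trans (cnorm_ge0 _).
apply: cnorm_row_le => [|j];
  first by rewrite mulr_ge0 ?cnorm_ge0// divr_ge0 ?mulr_ge0// ltW.
rewrite !mxE; apply: (@holomorphic_lipschitz _ _ (fun z => f z 0 j) p) => // y yr.
have [df fM] := fP y yr; split; first exact: differentiable_row_coord.
exact: le_trans (coord_le_cnorm _ _) fM.
Qed.

Lemma row_second_difference n (f : V -> 'rV[R[i]]_n) p (r M : R) : 0 < r ->
  (forall z, cnorm (z - p) < r -> differentiable f z /\ cnorm (f z) <= M) ->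
  forall c d, cnorm (c - p) < r / 16 -> cnorm d < r / 16 ->
    cnorm (f (c + d) + f (c - d) - 2 *: f c) <= 64 * M / r ^+ 2 * cnorm d ^+ 2.
Proof.
move=> r0 fP c d cr dr.
have M0 : 0 <= M.
  have [|_] := fP p; first by rewrite subrr /cnorm normr0.
  exact: le_trans (cnorm_ge0 _).
apply: cnorm_row_le => [|j].
  by rewrite mulr_ge0 ?exprn_ge0 ?cnorm_ge0// divr_ge0 ?mulr_ge0 ?exprn_ge0 ?(ltW r0).
rewrite !mxE; apply: (@holomorphic_second_difference _ _ (fun z => f z 0 j) p) => // y yr.
have [df fM] := fP y yr; split; first exact: differentiable_row_coord.
exact: le_trans (coord_le_cnorm _ _) fM.
Qed.

End LocalEstimates.

(* Pulling midpoints back from the image of [f] differs from taking midpoints in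
   the source only to second order. *)
Lemma pullback_midpoint (R : realType) (n : nat) (D E : set 'rV[R[i]]_n)
    (f g : 'rV[R[i]]_n -> 'rV[R[i]]_n) p :
  open D -> open E -> holomorphic_on D f -> holomorphic_on E g ->
  (forall z, D z -> E (f z) /\ g (f z) = z) -> D p ->
  exists r K : R, 0 < r /\ forall c d, cnorm (c - p) < r -> cnorm d < r ->
    cnorm (g (2^-1 *: f (c + d) + 2^-1 *: f (c - d)) - c) <= K * cnorm d ^+ 2.
Proof.
move=> oD oE hf hg fg Dp; have [Efp gfp] := fg p Dp.
have [r1 [M1 [r10 P1]]] := holomorphic_local_bound oD hf Dp.
have [r2 [M2 [r20 P2]]] := holomorphic_local_bound oE hg Efp.
have r240 : 0 < r2 / 4 by rewrite divr_gt0.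
have /continuous_cnormP/(_ _ r240)[r3 r30 P3] : {for p, continuous f}.
  exact/differentiable_continuous/hf.
have r116 : 0 < r1 / 16 by rewrite divr_gt0.
have r32 : 0 < r3 / 2 by rewrite divr_gt0.
(* The constant is the Lipschitz constant of [g] near [f p] times half the second-difference
   constant of [f]. The latter requires [r1 / 16]; [r3 / 2] keeps [f (c + d)] and [f (c - d)] within
   [r2 / 4] of [f p]. *)
exists (Num.min (r1 / 16) (r3 / 2)), (4 * M2 / r2 * (2^-1 * (64 * M1 / r1 ^+ 2))).
split; first by rewrite lt_min r116.
move=> c d; rewrite !lt_min => /andP[c1 c3] /andP[d1 d3].
have Pf z : cnorm (z - p) < r1 -> differentiable f z /\ cnorm (f z) <= M1 by move=> /P1[].
have Pg z : cnorm (z - f p) < r2 -> differentiable g z /\ cnorm (g z) <= M2 by move=> /P2[].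
have [Dc _ _] : [/\ D c, differentiable f c & cnorm (f c) <= M1].
  by apply: P1; apply: lt_trans c1 _; move: r10; clear; lra.
have [Ec gfc] := fg c Dc.
have r3r : r3 / 2 < r3 by move: r30; clear; lra.
have cm : cnorm (f c - f p) <= r2 / 4 by apply: P3; exact: lt_trans c3 r3r.
have cp : cnorm (f (c + d) - f p) <= r2 / 4.
  apply: P3; rewrite addrAC; apply: le_lt_trans (cnormD _ _) _.
  by move: c3 d3; clear; lra.
have cn : cnorm (f (c - d) - f p) <= r2 / 4.
  apply: P3; rewrite addrAC; apply: le_lt_trans (cnormB _ _) _.
  by move: c3 d3; clear; lra.
have half : cabs (2^-1 : R[i]) = 2^-1.
  have -> : (2^-1 : R[i]) = (2^-1)%:C by rewrite fmorphV rmorph_nat.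
  by rewrite cabs_real ger0_norm.
set u := 2^-1 *: f (c + d) + _;
  have uE : u - f c = 2^-1 *: (f (c + d) + f (c - d) - 2 *: f c).
  by rewrite /u scalerBr scalerDr scalerA mulVf ?pnatr_eq0// scale1r.
have um : cnorm (u - f p) <= r2 / 4.
  have -> : u - f p = 2^-1 *: (f (c + d) - f p) + 2^-1 *: (f (c - d) - f p).
    rewrite !scalerBr addrACA -opprD -scalerDl; congr (_ - _).
    by rewrite -[LHS]scale1r; congr (_ *: _); rewrite [LHS]splitr mul1r.
  apply: le_trans (cnormD _ _) _; rewrite !cnormZ !half.
  by move: cp cn; clear; lra.
have r24 : r2 / 4 < r2 / 2 by move: r20; clear; lra.
(* Writing [c] as [g (f c)] leaves the distance from [u] to [f c], half of a second difference. *)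
rewrite -[X in _ - X]gfc;
  apply: le_trans (row_lipschitz r20 Pg (le_lt_trans um r24) (le_lt_trans cm r24)) _.
have M20 : 0 <= M2.
  have [|_] := Pg (f p); first by rewrite subrr /cnorm normr0.
  exact: le_trans (cnorm_ge0 _).
rewrite -[leRHS]mulrA; apply: ler_wpM2l; first by rewrite divr_ge0 ?mulr_ge0// ltW.
rewrite uE cnormZ half -[leRHS]mulrA; apply: ler_wpM2l; first by rewrite invr_ge0.
exact: (row_second_difference r10 Pf c1 d1).
Qed.

(** * The weighted limit at 0 *)

Section HomogeneousLimit.
Context {R : realType} {n : nat}.

(* The maximum principle for the largest modulus of the roots, which is
   replaced by the growth of the inverse power series. *)
Lemma homogeneous_limit (phi : R[i] -> 'rV[R[i]]_n) (w : 'rV[R[i]]_n) (r K : R) :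
  0 < r ->
  (forall l, cabs l <= 1 -> symmetrized_polydisc R n (phi l) /\ differentiable phi l) ->
  (forall l, cabs l < r -> forall k,
    cabs (phi l 0 k - l ^+ k.+1 * w 0 k) <= K * cabs l ^+ n.+1) ->
  forall k, cabs (inv_coef (sigma_coef w) k) <= k.+1%:R ^+ n.
Proof.
move=> r0 phiP phiw k.
(* The dilate [l^-1 . phi l], completed by its limit at 0. *)
pose G (l : R[i]) : 'rV[R[i]]_n := if l == 0 then w else \row_j (phi l 0 j / l ^+ j.+1).
have cabs_gt0 (z : R[i]) : (0 < cabs z) = (z != 0) by rewrite -ltcR cabsE normr_gt0.
have Gnice j : holomorphic_off0 (fun l => G l 0 j).
  split.
    apply/continuous_cnormP => e e0.
    have K0 : 0 <= `|K| by [].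
    pose d := Num.min (Num.min r 1) (e / (`|K| + 1)).
    have d0 : 0 < d by rewrite !lt_min r0 ltr01 divr_gt0// ltr_wpDl.
    exists d => // l; rewrite subr0 !lt_min => /andP[/andP[lr l1] le].
    rewrite /G eqxx; case: eqVneq => [_|l0]; first by rewrite subrr /cnorm normr0 ltW.
    have lp : 0 < cabs l by rewrite cabs_gt0.
    rewrite mxE.
    have -> : phi l 0 j / l ^+ j.+1 - w 0 j = (phi l 0 j - l ^+ j.+1 * w 0 j) / l ^+ j.+1.
      by rewrite mulrBl mulrAC divff ?mul1r// expf_neq0.
    rewrite -[X in is_true X]/(cabs _ <= e).
    have -> : cabs ((phi l 0 j - l ^+ j.+1 * w 0 j) / l ^+ j.+1)
      = cabs (phi l 0 j - l ^+ j.+1 * w 0 j) / cabs l ^+ j.+1.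
      by apply: complexI; rewrite rmorphM/= fmorphV/= rmorphXn /= !cabsE normrM normfV
        normrX.
    rewrite ler_pdivrMr ?exprn_gt0//; apply: le_trans (phiw l lr j) _.
    (* As [j.+1 <= n], the exponent [n.+1] leaves a spare factor [cabs l] after the division. *)
    apply: (@le_trans _ _ (`|K| * (cabs l * cabs l ^+ j.+1))).
      apply: (@le_trans _ _ (`|K| * cabs l ^+ n.+1)).
        by rewrite ler_wpM2r ?exprn_ge0 ?cabs_ge0// ler_norm.
      rewrite ler_wpM2l// -exprS ler_wiXn2l ?cabs_ge0// ?ltnS//.
      exact: ltW.
    rewrite mulrA ler_wpM2r ?exprn_ge0 ?cabs_ge0//.
    apply: (@le_trans _ _ ((`|K| + 1) * cabs l)).
      by rewrite ler_wpM2r ?cabs_ge0// lerDl.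
    by rewrite mulrC -ler_pdivlMr ?ltr_wpDl// ltW.
  move=> z /andP[z0 z1].
  apply: (@near_eq_differentiable _ (fun l => phi l 0 j / l ^+ j.+1)).
    apply/near_cnorm; exists (cabs z) => // l lz.
    rewrite /G; case: eqVneq => [l0|_]; last by rewrite mxE.
    by move: lz; rewrite l0 sub0r cnormN ltxx.
  apply: differentiableM; first by apply: differentiable_row_coord; have [] := phiP z z1.
  apply: differentiableV; last by rewrite expf_neq0// -cabs_gt0.
  by apply/derivable1_diffP; exact: exprn_derivable.
have anice j : holomorphic_off0 (fun l => sigma_coef (G l) j).
  case: j => [|j] /=; first exact: holomorphic_off0_cst.
  apply: holomorphic_off0M; first exact: holomorphic_off0_cst.
  by case: insubP => [i _ _|_]; [exact: Gnice|exact: holomorphic_off0_cst].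
have [hc hd] := holomorphic_off0_inv_coef k anice.
have -> : w = G 0 by rewrite /G eqxx.
apply: (circle_cabs_le (f := fun l => inv_coef (sigma_coef (G l)) k) ltr01 hc).
  by move=> z; rewrite subr0; exact: hd.
move=> z; rewrite subr0 => z1.
have z0 : z != 0 by rewrite -cabs_gt0 z1.
have [[v vD vE] _] := phiP z (eq_ind_r (fun t => t <= 1) (lexx 1) z1).
(* On the unit circle the dilation only rotates the roots, which stay in the disc. *)
have -> : G z = sigma (z^-1 *: v).
  rewrite /G (negbTE z0); apply/rowP => j.
  by rewrite sigmaZ_coord mxE -vE mxE mulrC exprVn.
rewrite sigma_coefE; apply: inv_coef_root_poly => j; rewrite mxE cabsM.
have -> : cabs z^-1 = 1.
  by apply: complexI; rewrite cabsE normfV -cabsE z1 invr1.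
by rewrite mul1r -lecR cabsE ltW.
Qed.

End HomogeneousLimit.

(** * A midpoint witness contradicts convex exhaustion *)

Section Obstruction.
Context {R : realType} {n : nat}.
Implicit Types v : 'rV[R[i]]_n.

Lemma cnorm_sigmaZ_le v (l : R[i]) m : cabs l <= 1 ->
  (forall k, (0 < k < m)%N -> elem_sym k v = 0) ->
  cnorm (sigma (l *: v)) <= cnorm (sigma v) * cabs l ^+ m.
Proof.
move=> l1 ev; apply: cnorm_row_le => [|k].
  by rewrite mulr_ge0 ?exprn_ge0 ?cabs_ge0 ?cnorm_ge0.
rewrite sigmaZ_coord cabsM cabsX.
have [km|mk] := ltnP k.+1 m.
  by rewrite ev// /cabs normr0 mulr0 mulr_ge0 ?exprn_ge0 ?cabs_ge0 ?cnorm_ge0.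
rewrite mulrC; apply: ler_pM; rewrite ?exprn_ge0 ?cabs_ge0//.
  have -> : elem_sym k.+1 v = sigma v 0 k by rewrite mxE.
  exact: coord_le_cnorm.
by rewrite ler_wiXn2l ?cabs_ge0.
Qed.

Lemma midpoint_convex_set (V : lmodType R[i]) (E : set V) a b : convex_set E ->
  E a -> E b -> E (2^-1 *: a + 2^-1 *: b).
Proof.
move=> cE Ea Eb.
have h01 : 0 <= (2^-1 : R[i]) <= 1 by rewrite invr_ge0 ler0n invf_le1// ler1n.
have := cE a b (Itv01 (andP h01).1 (andP h01).2); rewrite !inE => /(_ Ea Eb).
have half : 1 - 2^-1 = 2^-1 :> R[i] by rewrite {1}[1]splitr mul1r addrK.
by rewrite /conv /= /unstable.onem half.
Qed.

Lemma convex_exhaustible_no_midpoint_witness :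
  convex_exhaustible (symmetrized_polydisc R n) -> ~ @midpoint_witness R n.
Proof.
move=> cvx [v1 [v2 [x [v1D v2D ev x1 xroot]]]].
pose disc := [set l : R[i] | cabs l <= 1].
pose z v l := sigma (l *: v).
have zc v : continuous (z v).
  by move=> l; apply/differentiable_continuous; exact: differentiable_sigmaZ.
(* Exhausting these two analytic discs defines the midpoints for every [l] in the closed disc. *)
pose K := (z v1 @` disc) `|` (z v2 @` disc).
have Kc : compact K.
  by apply: compactU; apply: continuous_compact compact_disc; exact: continuous_subspaceT.
have KG : K `<=` symmetrized_polydisc R n.
  by move=> _ [[l l1 <-]|[l l1 <-]]; [exists (l *: v1)|exists (l *: v2)] => //;
    exact: polydiscZ.
have [D [[_ oD _] KD DG [E [[_ oE _] cE [f [g [hf hg fg gf]]]]]]] := cvx K Kc KG.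
have zD1 l : cabs l <= 1 -> D (z v1 l) by move=> l1; apply: KD; left; exists l.
have zD2 l : cabs l <= 1 -> D (z v2 l) by move=> l1; apply: KD; right; exists l.
pose F l := 2^-1 *: f (z v1 l) + 2^-1 *: f (z v2 l).
pose phi l := g (F l).
have FE l : cabs l <= 1 -> E (F l).
  move=> l1; apply: midpoint_convex_set => //.
    by have [] := fg _ (zD1 l l1).
  by have [] := fg _ (zD2 l l1).
have phiP l : cabs l <= 1 -> symmetrized_polydisc R n (phi l) /\ differentiable phi l.
  move=> l1; split; first by apply: DG; have [] := gf _ (FE l l1).
  apply: (@differentiable_comp _ _ _ _ F g); last exact: hg (FE l l1).
  apply: differentiableD; apply: differentiableZ.
    apply: (@differentiable_comp _ _ _ _ (z v1) f); first exact: differentiable_sigmaZ.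
    exact: hf (zD1 l l1).
  apply: (@differentiable_comp _ _ _ _ (z v2) f); first exact: differentiable_sigmaZ.
  exact: hf (zD2 l l1).
pose w := 2^-1 *: (sigma v1 + sigma v2).
have z0 v : z v 0 = 0.
  by apply/rowP => k; rewrite sigmaZ_coord expr0n mul0r mxE.
have D0 : D 0 by rewrite -(z0 v1); apply: zD1; rewrite /cabs normr0.
have fg' y : D y -> E (f y) /\ g (f y) = y by move=> /fg.
have [r [L [r0 rL]]] := pullback_midpoint oD oE hf hg fg' D0.
(* The least [N] with [n < N.*2]; the weights known to vanish are those below [N]. *)
pose N := n./2.+1.
have nN : (n < N.*2)%N by rewrite /N doubleS -[in X in (X < _)%N](odd_double_half n);
  case: odd.
pose B := cnorm (sigma v1) + cnorm (sigma v2).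
have B0 : 0 <= B by rewrite addr_ge0 ?cnorm_ge0.
have evN k : (0 < k < N)%N -> elem_sym k v1 = 0 /\ elem_sym k v2 = 0.
  by move=> /andP[k0 kN]; apply: ev => //; rewrite -geq_half_double -ltnS.
(* Center and half-difference of the two points, the form that [pullback_midpoint] takes at the base
   point 0. Both are of order [cabs l ^+ N]. *)
pose c l := 2^-1 *: (z v1 l + z v2 l); pose d l := 2^-1 *: (z v1 l - z v2 l).
have half : cabs (2^-1 : R[i]) <= 1.
  have -> : (2^-1 : R[i]) = (2^-1)%:C by rewrite fmorphV rmorph_nat.
  by rewrite cabs_real ger0_norm// invf_le1// ler1n.
have zB l : cabs l <= 1 -> cnorm (z v1 l) + cnorm (z v2 l) <= B * cabs l ^+ N.
  move=> l1; rewrite mulrDl; apply: lerD; apply: cnorm_sigmaZ_le => // k /evN[] //.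
have cB l : cabs l <= 1 -> cnorm (c l) <= B * cabs l ^+ N.
  move=> l1; rewrite cnormZ; apply: le_trans (zB l l1); apply: le_trans (cnormD _ _).
  by rewrite ler_piMl// cnorm_ge0.
have dB l : cabs l <= 1 -> cnorm (d l) <= B * cabs l ^+ N.
  move=> l1; rewrite cnormZ; apply: le_trans (zB l l1); apply: le_trans (cnormB _ _).
  by rewrite ler_piMl// cnorm_ge0.
have avg (a : 'rV[R[i]]_n) : 2^-1 *: (a + a) = a.
  rewrite scalerDr -scalerDl -[RHS]scale1r; congr (_ *: _).
  by rewrite [RHS]splitr mul1r.
have cd1 l : c l + d l = z v1 l by rewrite -scalerDr addrACA subrr addr0 avg.
have cd2 l : c l - d l = z v2 l by rewrite -scalerBr opprB addrC addrA subrK avg.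
(* Since [N] is positive, this ensures [B * cabs l ^+ N < r]; the added 1 covers [B = 0]. *)
pose r' := Num.min 1 (r / (B + 1)).
have r'0 : 0 < r' by rewrite lt_min ltr01 divr_gt0// ltr_wpDl.
have lim := @homogeneous_limit R n phi w r' (`|L| * B ^+ 2) r'0 phiP.
have {}lim : forall k, cabs (inv_coef (sigma_coef w) k) <= k.+1%:R ^+ n.
  apply: lim => l; rewrite lt_min => /andP[/ltW l1 lr] k.
  have lN : B * cabs l ^+ N < r.
    apply: (@le_lt_trans _ _ ((B + 1) * cabs l)).
      apply: ler_pM; rewrite ?exprn_ge0 ?cabs_ge0 ?lerDl//.
      by rewrite -[leRHS]expr1 ler_wiXn2l ?cabs_ge0.
    by rewrite mulrC -ltr_pdivlMr// ltr_wpDl.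
  (* Averaging commutes with the weighted dilation: [l . w] is [c l]. *)
  have -> : phi l 0 k - l ^+ k.+1 * w 0 k = (phi l - c l) 0 k.
    rewrite [RHS]mxE [X in _ = _ + X]mxE; congr (_ - _).
    by rewrite /c /w !mxE !elem_symZ; ring.
  apply: le_trans (coord_le_cnorm _ _) _.
  have := rL (c l) (d l); rewrite subr0 cd1 cd2.
  move=> /(_ (le_lt_trans (cB l l1) lN) (le_lt_trans (dB l l1) lN)) H.
  apply: le_trans H _; rewrite -mulrA.
  apply: (@le_trans _ _ (`|L| * cnorm (d l) ^+ 2)).
    by rewrite ler_wpM2r ?exprn_ge0 ?cnorm_ge0// ler_norm.
  rewrite ler_wpM2l//.
  apply: (@le_trans _ _ ((B * cabs l ^+ N) ^+ 2)).
    by rewrite lerXn2r ?nnegrE ?cnorm_ge0 ?mulr_ge0 ?exprn_ge0 ?cabs_ge0 ?dB.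
  rewrite exprMn ler_wpM2l ?exprn_ge0// -exprM muln2.
  (* The squared half-difference has order [N.*2], at least the [n.+1] that [homogeneous_limit] asks
     for. *)
  by rewrite ler_wiXn2l ?cabs_ge0.
(* The coefficients of [Q] are those attached to [w], so the growth bound [lim] excludes its zero
   [x]. *)
pose Q := 2^-1 *: (root_poly v1 + root_poly v2).
have QE : sigma_coef w = nth 0 Q.
  apply/funext => j; rewrite coefZ coefD -!sigma_coefE; case: j => [|j] /=.
    by rewrite -[1 + 1]/(2 : R[i]) mulVf// pnatr_eq0.
  by case: insubP => [k _ _|_]; rewrite ?mxE; ring.
have Q0 : Q`_0 = 1 by rewrite -QE.
have := @inv_coef_horner_neq0 R Q n x Q0 _ x1.
by rewrite -QE => /(_ lim); rewrite hornerZ xroot mulr0 eqxx.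
Qed.

End Obstruction.

Theorem proposition3 (R : realType) (n : nat) (hn : (3 <= n)%N) :
  ~ convex_exhaustible (symmetrized_polydisc R n).
Proof.
by move=> /convex_exhaustible_no_midpoint_witness; apply; exact: exists_midpoint_witness.
Qed.
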